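(* Fix an integer $N\ge 0$ with $\Phi_K(\lambda_{N+1})>\operatorname{Cap}(K)$, and let $E$ be an arbitrary compact subset of $\{\mu\in\mathbb{C}:\Phi_K(\mu)<\Phi_K(\lambda_{N+1})\}\setminus\Lambda$. For each $S>N$ let $u_N^{\Xi_S}$ be a minimal rational interpolant of $u$ of type $[S-1/N]$ with samples at $\Xi_S$. Then there exists a constant $C_E$, independent of $S$ and $\varepsilon$, such that for every $\varepsilon>0$ there exists $S_{\varepsilon,N,E}$ with $$\left\|u(\mu)-u_N^{\Xi_S}(\mu)\right\|_V\leq C_E(1+\varepsilon)^{2S}\left(\frac{\Phi_K(\mu)}{\Phi_K(\lambda_{N+1})}\right)^S\quad\text{for all }\mu\in E,\ S>S_{\varepsilon,N,E}.$$
   Context: Target map. $V$ is a complex Hilbert space with inner product $\langle\cdot,\cdot\rangle_V$ and norm $\|\cdot\|_V$. The map $u$ is $V$-valued meromorphic on $\mathbb{C}$ with simple poles, $u(\mu)=\sum_{\lambda\in\Lambda}\frac{v_\lambda}{\lambda-\mu}$, with convergence in $V$ for an arbitrary ordering of $\Lambda$. The pole set $\Lambda\subset\mathbb{C}$ is countably infinite, with no finite limit point (hence unbounded). The residues $v_\lambda\in V\setminus\{0\}$ satisfy $\sum_{\lambda\in\Lambda}\|v_\lambda\|_V^2<\infty$ and are pairwise orthogonal: $\langle v_\lambda,v_{\lambda'}\rangle_V=0$ for $\lambda\ne\lambda'$. Parameter set and Green's potential. $K\subset\mathbb{C}$ is either the closure of the bounded region enclosed by a Jordan curve, or a line segment of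 positive length. $\operatorname{Cap}(K)>0$ is its logarithmic capacity, and $\phi_K$ is the conformal bijection from $\mathbb{C}\setminus K$ onto $\{z\in\mathbb{C}:|z|>\operatorname{Cap}(K)\}$ with $\lim_{\mu\to\infty}|\phi_K'(\mu)|=1$ (one has $|\phi_K|=\operatorname{Cap}(K)$ on $\partial K$ by continuity). Set $\Phi_K(\mu)=|\phi_K(\mu)|$ for $\mu\notin K$ and $\Phi_K(\mu)=\operatorname{Cap}(K)$ for $\mu\in K$. The poles are ordered $\Lambda=\{\lambda_j\}_{j\ge1}$ so that $\Phi_K(\lambda_1)\le\Phi_K(\lambda_2)\le\cdots$. Sample points. For a finite set $\Xi$, $\omega^\Xi(\mu)=\prod_{\mu'\in\Xi}(\mu-\mu')$. For each $S\ge1$, $\Xi_S\subset K$ is the set of $S$ Fejér points for $K$; the sequence $(\Xi_S)_S$ satisfies $\limsup_{S\to\infty}|\omega^{\Xi_S}|^{1/S}\le\Phi_K$ uniformly on compact subsets of $\mathbb{C}$, and $\lim_{S\to\infty}|\omega^{\Xi_S}|^{1/S}=\Phi_K$ uniformly on compact subsets of $\mathbb{C}\setminus\partial K$. Sample points are not poles of $u$: $\Xi_S\cap\Lambda=\emptyset$. Minimal rational interpolants. $\mathbb{P}_N(\mathbb{C})$ is the space of complex polynomials of degree at most $N$, with a fixed (arbitrary) Hilbertian norm $|||\cdot|||_N$, and $\mathbb{P}_N^\star(\mathbb{C})=\{Q\in\mathbb{P}_N(\mathbb{C}):|||Q|||_N=1\}$. $I^{\Xi_S}$ is polynomial interpolation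 at $\Xi_S$: $I^{\Xi_S}(\phi)$ is the $V$-valued polynomial of degree at most $S-1$ agreeing with $\phi$ on $\Xi_S$ (in the Hermite sense for repeated points). For $0\le N\le S-1$ and $Q\in\mathbb{P}_N(\mathbb{C})$ set $j^{\Xi_S}(Q)=\left\|\frac{1}{(S-1)!}\frac{d^{S-1}}{d\mu^{S-1}}I^{\Xi_S}(uQ)\right\|_V$. A minimal rational interpolant of $u$ of type $[S-1/N]$ with samples at $\Xi_S$ is $u_N^{\Xi_S}(\mu)=I^{\Xi_S}(uQ_N^{\Xi_S})(\mu)/Q_N^{\Xi_S}(\mu)$ (for $Q_N^{\Xi_S}(\mu)\ne0$), where the denominator $Q_N^{\Xi_S}$ is a minimizer of $j^{\Xi_S}$ over $\mathbb{P}_N^\star(\mathbb{C})$.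
   Formalization: The formal theorem additionally assumes, for N ≥ 1, Φ_K(λ_j) < Φ_K(λ_{N+1}) for all j ≤ N; without it the claim fails when Φ_K(λ_N) = Φ_K(λ_{N+1}), since a zero of the denominator can stay inside E for infinitely many S. *)

(* Defs.v *)
(* MathComp / MathComp-Analysis.  Complex numbers are R[i] for R : realType. *)
From HB Require Import structures.
From mathcomp Require Import all_boot all_order all_algebra.
From mathcomp Require Import complex.
From mathcomp Require Import all_classical all_reals all_analysis.

Set Implicit Arguments.
Unset Strict Implicit.
Unset Printing Implicit Defensive.

Import Order.TTheory GRing.Theory Num.Theory.
Import numFieldNormedType.Exports.

Local Open Scope classical_set_scope.
Local Open Scope complex_scope.
Local Open Scope ring_scope.

(* R[i] with the topology of its modulus: for the concrete type R[i] this has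
   to be copied from R[i]^o, as numFieldNormedType does for abstract fields. *)
#[warnings="-redundant-canonical-projection"]
HB.instance Definition _ (R : realType) := NormedModule.copy R[i] R[i]^o.

Section Norms.
Context {R : realType}.

(* Norms over R[i] take their values in R[i]; this is the same norm as an
   element of R. *)
Definition rnorm (V : normedZmodType R[i]) (x : V) : R := complex.Re `|x|.

(* The Hilbertian norm of an inner product, which is linear in its first
   argument and conjugate-linear in the second one. *)
Definition hnorm (U : lmodType R[i]) (ip : {dot U for (@Num.conj R[i])})
  (x : U) : R[i] := sqrtC (ip x x).

End Norms.

Section ParameterSet.
Context {R : realType}.
Implicit Types (K J D : set R[i]) (phi : R[i] -> R[i]).

Definition jordan_curve J := exists g : R -> R[i],
  [/\ {within `[0, 1], continuous g}, g 0 = g 1,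
      {in `[0, 1[ &, injective g} & J = g @` `[0, 1]].

(* The region enclosed by J is the bounded connected component of ~` J. *)
Definition closed_jordan_region K := exists J D,
  [/\ jordan_curve J,
      exists2 z, ~ J z & D = connected_component (~` J) z,
      bounded_set D & K = closure D].

Definition line_segment K := exists a b : R[i],
  a != b /\ K = [set a + t%:C * (b - a) | t in `[0, 1]].

(* Probability measures on the complex plane are taken on R * R, so as to use
   its product (Borel) sigma-algebra. *)
Definition to_complex (p : measurableTypeR R * measurableTypeR R) : R[i] :=
  (p.1 : R) +i* (p.2 : R).

Definition log_kernel (p q : measurableTypeR R * measurableTypeR R) : \bar R :=
  if p == q then +oo%E else (- ln (rnorm (to_complex p - to_complex q)))%:E.

Definition log_energy
    (m : probability (measurableTypeR R * measurableTypeR R)%type R) : \bar R :=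
  (\int[m]_p \int[m]_q log_kernel p q)%E.

(* exp (- inf_m log_energy m), m ranging over the probability measures carried
   by K; it is 0 when every such m has infinite energy. *)
Definition capacity K : R :=
  fine (expeR (- ereal_inf [set log_energy m |
    m in [set m' : probability (measurableTypeR R * measurableTypeR R)%type R |
          m' (to_complex @^-1` K) = 1%E]]))%E.

Definition holomorphic_on (V : normedModType R[i]) D (f : R[i] -> V) :=
  forall z, D z -> derivable f z 1.

Definition conformal_exterior K phi :=
  [/\ holomorphic_on (~` K) phi,
      set_bij (~` K) [set z | capacity K < rnorm z] phi &
      forall e : R, 0 < e -> exists M : R, forall z : R[i], M < rnorm z ->
        `|rnorm (derive1 phi z) - 1| < e].

Definition green K phi (z : R[i]) : R :=
  if z \in K then capacity K else rnorm (phi z).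

Definition frontier K : set R[i] := closure K `\` interior K.

End ParameterSet.

Section SamplePoints.
Context {R : realType}.
Implicit Types (K F : set R[i]) (phi : R[i] -> R[i]) (Xi : seq R[i]).

Definition unit_root (S k : nat) : R[i] :=
  cos (2 * pi * k%:R / S%:R) +i* sin (2 * pi * k%:R / S%:R).

(* The Fejer points are the images of Cap(K) e^{2 i pi k / S} under the
   extension by continuity of phi^-1 to the circle |z| = Cap(K). They are kept
   in a sequence because that extension is 2-to-1 when K is a segment, where
   points get repeated. *)
Definition fejer_points K phi (S : nat) Xi :=
  size Xi = S /\
  forall k, (k < S)%N ->
    'pinv_(fun=> 0) (~` K) phi z
      @[z --> within [set z | capacity K < rnorm z]
                     (nbhs ((capacity K)%:C * unit_root S k))]
    --> (nth 0 Xi k : R[i]).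

Definition nodal Xi (z : R[i]) : R[i] := \prod_(x <- Xi) (z - x).

Definition nodal_root (Xi : nat -> seq R[i]) (S : nat) (z : R[i]) : R :=
  rnorm (nodal (Xi S) z) `^ S%:R^-1.

Definition limsup_le_compacts (f : nat -> R[i] -> R) (g : R[i] -> R) :=
  forall F, compact F -> forall e : R, 0 < e ->
    exists S0 : nat, forall S z, (S0 <= S)%N -> F z -> f S z <= g z + e.

Definition lim_compacts_in D (f : nat -> R[i] -> R) (g : R[i] -> R) :=
  forall F, compact F -> F `<=` D -> forall e : R, 0 < e ->
    exists S0 : nat, forall S z, (S0 <= S)%N -> F z -> `|f S z - g z| < e.

End SamplePoints.

Section TargetMap.
Context {R : realType} {V : normedModType R[i]}.
Implicit Types (Lam : set R[i]) (v u : R[i] -> V).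

Definition meromorphic_simple_poles Lam u :=
  holomorphic_on (~` Lam) u /\
  forall l, Lam l ->
    exists2 r : V, r != 0 & (z - l) *: u z @[z --> l^'] --> r.

Definition pole_expansion Lam v u :=
  forall s : nat -> R[i], set_bij [set: nat] Lam s ->
  forall z, ~ Lam z ->
    (\sum_(0 <= k < n) (s k - z)^-1 *: v (s k)) @[n --> \oo] --> u z.

(* Poles are numbered from 0: lam j stands for lambda_{j+1}. *)
Definition ordered_enumeration Lam (Phi : R[i] -> R) (lam : nat -> R[i]) :=
  set_bij [set: nat] Lam lam /\
  forall i j, (i <= j)%N -> Phi (lam i) <= Phi (lam j).

(* lambda_1, ..., lambda_N are exactly the poles on levels below the one of
   lambda_{N+1}. When lambda_N and lambda_{N+1} are on the same level, a zero
   of the denominators of type [S-1/N] can stay away from Lam and below that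
   level for infinitely many S. *)
Definition level_gap (Phi : R[i] -> R) (lam : nat -> R[i]) (N : nat) :=
  forall j, (j < N)%N -> Phi (lam j) < Phi (lam N).

End TargetMap.

Section Interpolation.
Context {R : realType} {V : normedModType R[i]}.
Implicit Types (Xi : seq R[i]) (f p u : R[i] -> V).

Definition hermite_interpolant Xi f p :=
  (exists c : nat -> V, p = fun z => \sum_(i < size Xi) z ^+ i *: c i) /\
  forall x k, (k < count_mem x Xi)%N -> derive1n k p x = derive1n k f x.

(* The interpolant, which is unique. *)
Definition interpolate Xi f : R[i] -> V :=
  xget (fun=> 0) [set p | hermite_interpolant Xi f p].

Definition scaled u (Q : {poly R[i]}) : R[i] -> V := fun z => Q.[z] *: u z.

(* With S = size Xi, the (S-1)-th derivative is constant. *)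
Definition jfun u Xi (Q : {poly R[i]}) : R :=
  rnorm (((size Xi).-1)`!%:R^-1 *:
         derive1n (size Xi).-1 (interpolate Xi (scaled u Q)) 0).

(* {poly_N.+1 R[i]} is the space of polynomials of degree at most N. *)
Definition minimal_denominator (N : nat)
    (ip : {dot {poly_N.+1 R[i]} for (@Num.conj R[i])}) u Xi
    (Q : {poly_N.+1 R[i]}) :=
  hnorm ip Q = 1 /\
  forall P : {poly_N.+1 R[i]}, hnorm ip P = 1 -> jfun u Xi Q <= jfun u Xi P.

(* Meaningful only where Q does not vanish. *)
Definition rational_interpolant u Xi (Q : {poly R[i]}) : R[i] -> V :=
  fun z => Q.[z]^-1 *: interpolate Xi (scaled u Q) z.

End Interpolation.

(* Main.v *)
Require Import Defs.
From HB Require Import structures.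
From mathcomp Require Import all_boot all_order all_algebra.
From mathcomp Require Import complex.
From mathcomp Require Import all_classical all_reals all_analysis.
From mathcomp Require Import ring lra.

(** Why the theorem holds.  Write w_k = v(lambda_k).  Since the w_k are
    orthogonal and square summable, every bounded sequence a of scalars has a
    sum T(a) = sum_k a_k w_k (oseries), and by Pythagoras the norm of T(a)
    bounds each |a_k| |w_k|, is at most a constant times sup |a_k|, and is
    monotone in the moduli |a_k|.  The target map is u(z) = T(1/(lambda_k - z)).

    For a single pole the interpolation error is explicit: if omega is the
    nodal polynomial and deg Q < deg omega, the polynomial
      (Q(z) - Q(lambda) omega(z) / omega(lambda)) / (lambda - z)
    interpolates Q(z)/(lambda - z) at the zeros of omega, and its coefficient
    of degree S - 1 is Q(lambda)/omega(lambda).  Summing over the poles with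
    a_k = Q(lambda_k)/omega(lambda_k) gives
      j(Q) = |T(a)|   and   (uQ - I(uQ))(z) = omega(z) T(a_k/(lambda_k - z))
    (jfunE, interpolation_error).  As z ranges over a compact set at distance
    d > 0 from the poles, monotonicity bounds the error of the rational
    interpolant by |omega(z)| j(Q) / (d |Q(z)|), so three estimates remain.

    - |omega(z)| is at most ((1 + eps) Phi(z))^S, because Phi is bounded below by
      the capacity, which turns the additive error in the n-th root asymptotics
      into a relative one.
    - With sigma the level of lambda_{N+1}, j(Q_S) is at most
      C ((1 + eps)/sigma)^S (minimal_jfun_le): compare with the normalized
      polynomial of degree N that vanishes at the first N poles.  The remaining
      poles are at level at least sigma; on the finitely many near ones omega is
      controlled by the n-th root asymptotics, on the far ones by
      |omega| >= (|lambda| - rho)^S, since K lies in a disc of radius rho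
      (poly_le_nodal).
    - |Q_S| is bounded below on E for large S.  For j <= N, orthogonality bounds
      |Q_S(lambda_j)| by j(Q_S) |omega(lambda_j)| / |w_j|, which tends to 0
      because lambda_j is on a level below sigma (minimal_denominator_small).
      Thus in the Lagrange basis at the first N+1 poles the unit vector Q_S is
      asymptotically carried by the element whose zeros are the first N poles,
      and those are at positive distance from E (denominator_lower_bound). *)

Set Implicit Arguments.
Unset Strict Implicit.
Unset Printing Implicit Defensive.

Import Order.TTheory GRing.Theory Num.Theory.
Import numFieldNormedType.Exports.

Local Open Scope classical_set_scope.
Local Open Scope ring_scope.

(** * The real-valued norm of a space over the complex numbers *)

Section RealNorm.
Context {R : realType}.
Implicit Types (V : normedModType R[i]).

Lemma rnormE (V : normedZmodType R[i]) (x : V) : `|x| = (rnorm x)%:C%C.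
Proof. by rewrite /rnorm (RRe_real (ger0_real (normr_ge0 x))). Qed.

Lemma rnorm_ge0 (V : normedZmodType R[i]) (x : V) : 0 <= rnorm x.
Proof. by rewrite -lecR -rnormE normr_ge0. Qed.

Lemma rnormD (V : normedZmodType R[i]) (x y : V) :
  rnorm (x + y) <= rnorm x + rnorm y.
Proof. by rewrite -lecR rmorphD/= -!rnormE ler_normD. Qed.

Lemma rnormN (V : normedZmodType R[i]) (x : V) : rnorm (- x) = rnorm x.
Proof. by rewrite /rnorm normrN. Qed.

Lemma rnormBC (V : normedZmodType R[i]) (x y : V) : rnorm (x - y) = rnorm (y - x).
Proof. by rewrite -rnormN opprB. Qed.

Lemma rnormB (V : normedZmodType R[i]) (x y : V) :
  rnorm x - rnorm y <= rnorm (x - y).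
Proof. by rewrite lerBlDr (le_trans _ (rnormD _ _)) // subrK. Qed.

Lemma rnorm0 (V : normedZmodType R[i]) : rnorm (0 : V) = 0.
Proof. by rewrite /rnorm normr0. Qed.

Lemma rnorm_eq0 (V : normedZmodType R[i]) (x : V) : (rnorm x == 0) = (x == 0).
Proof. by rewrite -[RHS]normr_eq0 rnormE; apply/eqP/eqP => [->//|/complexI]. Qed.

Lemma rnorm_gt0 (V : normedZmodType R[i]) (x : V) : (0 < rnorm x) = (x != 0).
Proof. by rewrite lt_def rnorm_eq0 rnorm_ge0 andbT. Qed.

Lemma rnormZ V (a : R[i]) (x : V) : rnorm (a *: x) = rnorm a * rnorm x.
Proof. by apply: complexI; rewrite rmorphM/= -!rnormE normrZ. Qed.

Lemma rnormM (a b : R[i]) : rnorm (a * b) = rnorm a * rnorm b.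
Proof. by apply: complexI; rewrite rmorphM/= -!rnormE normrM. Qed.

Lemma rnorm1 : rnorm (1 : R[i]) = 1.
Proof. by rewrite /rnorm normr1. Qed.

Lemma rnormX (a : R[i]) n : rnorm (a ^+ n) = rnorm a ^+ n.
Proof. by elim: n => [|n IHn]; rewrite ?expr0 ?rnorm1 // !exprS rnormM IHn. Qed.

Lemma rnormV (a : R[i]) : rnorm a^-1 = (rnorm a)^-1.
Proof. by apply: complexI; rewrite fmorphV/= -!rnormE normfV. Qed.

Lemma rnorm_prod (I : Type) (s : seq I) (P : pred I) (F : I -> R[i]) :
  rnorm (\prod_(i <- s | P i) F i) = \prod_(i <- s | P i) rnorm (F i).
Proof. exact: (big_morph _ rnormM rnorm1). Qed.

Lemma rnorm_sum (V : normedZmodType R[i]) (I : Type) (s : seq I) (P : pred I)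
    (F : I -> V) :
  rnorm (\sum_(i <- s | P i) F i) <= \sum_(i <- s | P i) rnorm (F i).
Proof.
elim/big_rec2 : _ => [|i y x _ xy]; first by rewrite rnorm0.
by rewrite (le_trans (rnormD _ _)) // lerD2l.
Qed.

Lemma rnorm_real (x : R) : 0 <= x -> rnorm (x%:C%C : R[i]) = x.
Proof. by move=> x0; rewrite /rnorm ger0_norm // ler0c. Qed.

Lemma rnorm_pos (x : R[i]) : 0 <= x -> x = (rnorm x)%:C%C.
Proof. by move=> x0; rewrite -rnormE ger0_norm. Qed.

(** Limits in a space over R[i] quantify over positive elements of R[i]; with
    this form all estimates can be made in the totally ordered field R. *)
Lemma cvg_rnormP V T (F : set_system T) {FF : Filter F} (f : T -> V) (l : V) :
  f @ F --> l <-> forall e : R, 0 < e -> \forall x \near F, rnorm (l - f x) < e.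
Proof.
split=> [/cvgrPdist_lt fl e e0|fl].
  have e0' : (0 : R[i]) < e%:C%C by rewrite (ltcR 0 e).
  by apply: filterS (fl _ e0') => x; rewrite rnormE ltcR.
apply/cvgrPdist_lt => e e0.
have := e0; rewrite (rnorm_pos (ltW e0)) (ltcR 0 _) => /fl.
by apply: filterS => x; rewrite rnormE ltcR.
Qed.

Lemma cvgn_rnormP V (f : nat -> V) (l : V) :
  f @ \oo --> l <-> forall e : R, 0 < e ->
    exists n0, forall n, (n0 <= n)%N -> rnorm (l - f n) < e.
Proof.
rewrite cvg_rnormP; split => fl e /fl.
  by case=> n0 _ fn; exists n0.
by case=> n0 fn; exists n0.
Qed.

Lemma nbhs_rnormP V (x : V) (A : set V) :
  nbhs x A <-> exists2 e : R, 0 < e & forall y, rnorm (x - y) < e -> A y.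
Proof.
split.
  move/nbhs_normP => [e /= e0 eA]; exists (rnorm e).
    by rewrite rnorm_gt0 gt_eqF.
  by move=> y xy; apply: eA; rewrite /= rnormE (rnorm_pos (ltW e0)) ltcR.
move=> [e e0 eA]; apply/nbhs_normP; exists e%:C%C => /=; first by rewrite (ltcR 0 e).
by move=> y; rewrite /= rnormE ltcR => /eA.
Qed.

Lemma rnorm_cvg_le V (f : nat -> V) (l : V) (b : R) :
  f @ \oo --> l -> (exists n0, forall n, (n0 <= n)%N -> rnorm (f n) <= b) ->
  rnorm l <= b.
Proof.
move=> /cvgn_rnormP fl [n0 fb]; apply/ler_addgt0Pr => e e0.
have [n1 fe] := fl _ e0; set n := maxn n0 n1.
have := rnormD (l - f n) (f n); rewrite subrK => /le_trans; apply.
by rewrite addrC lerD ?fb ?leq_maxl // ltW // fe // leq_maxr.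
Qed.

Lemma rnorm_cvg_ge V (f : nat -> V) (l : V) (b : R) :
  f @ \oo --> l -> (exists n0, forall n, (n0 <= n)%N -> b <= rnorm (f n)) ->
  b <= rnorm l.
Proof.
move=> /cvgn_rnormP fl [n0 fb]; apply/ler_addgt0Pr => e e0.
have [n1 fe] := fl _ e0; set n := maxn n0 n1.
rewrite (le_trans (fb n (leq_maxl _ _))) // -lerBlDl.
rewrite (le_trans (rnormB _ _)) // rnormBC ltW // fe // leq_maxr //.
Qed.

Lemma rnorm_continuous V : continuous (@rnorm R V).
Proof.
move=> x; apply/cvgrPdist_lt => e e0; apply/nbhs_rnormP; exists e => // y xy.
rewrite (le_lt_trans _ xy) // ler_norml rnormB andbT lerNl opprB rnormBC.
exact: rnormB.
Qed.

Lemma compact_rnorm_bounded V (E : set V) :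
  compact E -> exists2 M : R, 0 < M & forall z, E z -> rnorm z <= M.
Proof.
move=> cE.
have : compact (@rnorm R V @` E).
  by apply: continuous_compact => //; apply/continuous_subspaceT/rnorm_continuous.
move/compact_bounded => [M [_ MB]]; exists (`|M| + 1); first by rewrite ltr_pwDr.
move=> z Ez; have /(_ (`|M| + 1)) := MB; rewrite ltr_pwDr ?ler_norm// => /(_ isT).
by move=> /(_ (rnorm z)) /=; rewrite ger0_norm ?rnorm_ge0 //; apply; exists z.
Qed.

End RealNorm.

(** * Sums over an orthogonal family with bounded coefficients *)

Definition bounded_coef {R : realType} (a : nat -> R[i]) :=
  exists M : R, forall k, rnorm (a k) <= M.

(** The sum of the series with terms a k *: w k; it is a limit of partial sums
    when w is orthogonal and square summable and a is bounded. *)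
Definition oseries {R : realType} {V : normedModType R[i]} (w : nat -> V)
    (a : nat -> R[i]) : V :=
  limn (fun n => \sum_(0 <= k < n) a k *: w k).

Section BoundedCoef.
Context {R : realType}.
Implicit Types a b : nat -> R[i].

Lemma bounded_coefD a b :
  bounded_coef a -> bounded_coef b -> bounded_coef (fun k => a k + b k).
Proof.
move=> [M aM] [M' bM]; exists (M + M') => k.
by rewrite (le_trans (rnormD _ _)) // lerD.
Qed.

Lemma bounded_coefM a b :
  bounded_coef a -> bounded_coef b -> bounded_coef (fun k => a k * b k).
Proof.
move=> [M aM] [M' bM]; exists (M * M') => k.
by rewrite rnormM ler_pM // rnorm_ge0.
Qed.

Lemma bounded_coefC (c : R[i]) : bounded_coef (fun=> c).
Proof. by exists (rnorm c). Qed.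

Lemma bounded_coefB a b :
  bounded_coef a -> bounded_coef b -> bounded_coef (fun k => a k - b k).
Proof.
move=> ba [M bM]; apply: bounded_coefD => //.
by exists M => k; rewrite rnormN.
Qed.

Lemma bounded_coefX a m : bounded_coef a -> bounded_coef (fun k => a k ^+ m).
Proof.
move=> ba; elim: m => [|m IHm]; first exact: bounded_coefC.
by under eq_fun do rewrite exprS; apply: bounded_coefM.
Qed.

(** Estimates at the poles are available for large modulus; the finitely many
    other indices do not affect boundedness. *)
Lemma bounded_coef_near a :
  (exists n0 (M : R), forall k, (n0 <= k)%N -> rnorm (a k) <= M) ->
  bounded_coef a.
Proof.
move=> [n0 [M aM]]; exists (\sum_(k < n0) rnorm (a k) + `|M|) => k.
have [kn|kn] := ltnP k n0.
  rewrite (bigD1 (Ordinal kn)) //= -addrA lerDl addr_ge0 //.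
  by apply: sumr_ge0 => i _; exact: rnorm_ge0.
rewrite (le_trans (aM k kn)) // (le_trans (ler_norm _)) // lerDr.
by apply: sumr_ge0 => i _; exact: rnorm_ge0.
Qed.

End BoundedCoef.

Section OrthogonalSeries.
Context {R : realType} {V : completeNormedModType R[i]}.
Variable dot : {dot V for (@Num.conj R[i])}.
Hypothesis dot_norm : forall x : V, dot x x = `|x| ^+ 2.
Variables (w : nat -> V) (B : R).
Hypothesis w_orth : forall i j, i != j -> dot (w i) (w j) = 0.
Hypothesis B_ge0 : 0 <= B.
Hypothesis w_sqr : forall n, \sum_(0 <= k < n) rnorm (w k) ^+ 2 <= B ^+ 2.
Implicit Types a b : nat -> R[i].

Lemma rnorm_orthD (x y : V) :
  dot x y = 0 -> rnorm (x + y) ^+ 2 = rnorm x ^+ 2 + rnorm y ^+ 2.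
Proof.
move=> xy; apply: complexI; rewrite rmorphD !rmorphXn/= -!rnormE -!dot_norm.
by rewrite dnormD xy conjC0 !addr0.
Qed.

Lemma pythagoras a (s : seq nat) : uniq s ->
  rnorm (\sum_(k <- s) a k *: w k) ^+ 2 =
  \sum_(k <- s) rnorm (a k) ^+ 2 * rnorm (w k) ^+ 2.
Proof.
elim: s => [|i s IHs] /=; first by rewrite !big_nil rnorm0 expr0n.
move=> /andP[i_s us]; rewrite !big_cons rnorm_orthD ?IHs ?rnormZ ?exprMn //.
rewrite linear_sumr big_seq big1 // => j js.
rewrite linearZr_LR linearZl_LR /= w_orth ?mulr0 ?scaler0 //.
by apply: contraNneq i_s => ->.
Qed.

(** By Pythagoras a block of the series is bounded by sup |a| times the
    corresponding block of the convergent series of the squared norms of w, so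
    the partial sums are Cauchy. *)
Lemma oseries_cvg a : bounded_coef a ->
  (fun n => \sum_(0 <= k < n) a k *: w k) @ \oo --> oseries w a.
Proof.
move=> [M aM].
suff: cvgn (series (fun k => a k *: w k)) by [].
have cvg_sqr : cvgn (series (fun k => rnorm (w k) ^+ 2)).
  apply: nondecreasing_is_cvgn; last by exists (B ^+ 2) => _ [n _ <-]; exact: w_sqr.
  by apply/nondecreasing_seqP => n; rewrite /series/= big_nat_recr//= lerDl sqr_ge0.
apply/cauchy_cvgP/cauchy_seriesP => e e0.
have M0 : 0 <= M by exact: le_trans (rnorm_ge0 _) (aM 0).
have := e0; rewrite (rnorm_pos (ltW e0)) (ltcR 0 _) => re0.
have : 0 < (rnorm e / (M + 1)) ^+ 2 by rewrite exprn_gt0 // divr_gt0 // ltr_pwDr.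
move/cauchy_cvgP/cauchy_seriesP : cvg_sqr => /[apply].
apply: filterS => -[m n] /=; rewrite rnormE ltcR => lte.
rewrite -(@ltr_pXn2r _ 2) ?nnegrE ?rnorm_ge0 // pythagoras ?iota_uniq //.
have : \sum_(m <= k < n) rnorm (a k) ^+ 2 * rnorm (w k) ^+ 2 <=
       (M + 1) ^+ 2 * \sum_(m <= k < n) rnorm (w k) ^+ 2.
  rewrite mulr_sumr ler_sum // => k _; rewrite ler_wpM2r ?sqr_ge0 //.
  by rewrite lerXn2r ?nnegrE ?rnorm_ge0 ?addr_ge0 // (le_trans (aM k)) // lerDl.
move=> /le_lt_trans; apply.
rewrite -ltr_pdivlMl ?exprn_gt0 ?ltr_pwDr // mulrC -expr_div_n.
by apply: le_lt_trans lte; exact: ler_norm.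
Qed.

Lemma oseries_unique a (x : V) :
  (fun n => \sum_(0 <= k < n) a k *: w k) @ \oo --> x -> oseries w a = x.
Proof. by move=> ax; apply: (@norm_cvg_lim _ V). Qed.

Lemma oseriesD a b : bounded_coef a -> bounded_coef b ->
  oseries w (fun k => a k + b k) = oseries w a + oseries w b.
Proof.
move=> ba bb; apply: oseries_unique.
under eq_fun do under eq_bigr do rewrite scalerDl.
under eq_fun do rewrite big_split /=.
exact: cvgD (oseries_cvg ba) (oseries_cvg bb).
Qed.

Lemma oseriesB a b : bounded_coef a -> bounded_coef b ->
  oseries w (fun k => a k - b k) = oseries w a - oseries w b.
Proof.
move=> ba bb; apply: oseries_unique.
under eq_fun do under eq_bigr do rewrite scalerBl.
under eq_fun do rewrite sumrB.
exact: cvgB (oseries_cvg ba) (oseries_cvg bb).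
Qed.

Lemma oseriesZ (c : R[i]) a : bounded_coef a ->
  oseries w (fun k => c * a k) = c *: oseries w a.
Proof.
move=> ba; apply: oseries_unique.
under eq_fun do under eq_bigr do rewrite -scalerA.
under eq_fun do rewrite -scaler_sumr.
apply: cvgZr; exact: oseries_cvg.
Qed.

Lemma oseries0 : oseries w (fun=> 0) = 0.
Proof.
have := oseriesZ 0 (bounded_coefC 0); rewrite scale0r => <-.
by congr (oseries w _); apply/funext => k; rewrite mul0r.
Qed.

Lemma oseries_sum (I : Type) (s : seq I) (a : I -> nat -> R[i]) :
  (forall i, bounded_coef (a i)) ->
  oseries w (fun k => \sum_(i <- s) a i k) = \sum_(i <- s) oseries w (a i).
Proof.
move=> ba.
suff: bounded_coef (fun k => \sum_(i <- s) a i k) /\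
   oseries w (fun k => \sum_(i <- s) a i k) = \sum_(i <- s) oseries w (a i) by case.
elim: s => [|i s [bs IHs]].
  under eq_fun do rewrite big_nil; rewrite big_nil oseries0; split => //.
  exact: bounded_coefC.
under eq_fun do rewrite big_cons; rewrite big_cons -IHs oseriesD//; split => //.
exact: bounded_coefD.
Qed.

Lemma rnorm_partial_sum_le a n : bounded_coef a ->
  rnorm (\sum_(0 <= k < n) a k *: w k) <= rnorm (oseries w a).
Proof.
move=> ba; apply: rnorm_cvg_ge (oseries_cvg ba) _; exists n => m nm.
rewrite -(@ler_pXn2r _ 2) ?nnegrE ?rnorm_ge0 // !pythagoras ?iota_uniq //.
rewrite (@big_cat_nat _ _ _ n 0 m) //= lerDl.
by apply: sumr_ge0 => i _; rewrite mulr_ge0 // sqr_ge0.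
Qed.

(** Pythagoras compares the partial sums termwise. This removes from an
    interpolation error its only dependence on z besides the nodal polynomial:
    the factors 1 / (lam k - z). *)
Lemma oseries_le a b (c : R) : bounded_coef b -> 0 <= c ->
  (forall k, rnorm (a k) <= c * rnorm (b k)) ->
  rnorm (oseries w a) <= c * rnorm (oseries w b).
Proof.
move=> bb c0 ab.
have ba : bounded_coef a.
  by have [M bM] := bb; exists (c * M) => k; rewrite (le_trans (ab k)) // ler_wpM2l.
apply: rnorm_cvg_le (oseries_cvg ba) _; exists 0 => n _.
apply: le_trans (ler_wpM2l c0 (rnorm_partial_sum_le n bb)).
rewrite -(@ler_pXn2r _ 2) ?nnegrE ?mulr_ge0 ?rnorm_ge0 // exprMn.
rewrite !pythagoras ?iota_uniq // mulr_sumr ler_sum // => k _.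
rewrite [leRHS]mulrA -[X in _ <= X * _]exprMn ler_wpM2r ?sqr_ge0 //.
by rewrite lerXn2r ?nnegrE ?mulr_ge0 ?rnorm_ge0.
Qed.

Lemma oseries_bound a (M : R) : (forall k, rnorm (a k) <= M) ->
  rnorm (oseries w a) <= B * M.
Proof.
move=> aM; have M0 : 0 <= M by exact: le_trans (rnorm_ge0 _) (aM 0).
have ba : bounded_coef a by exists M.
apply: rnorm_cvg_le (oseries_cvg ba) _; exists 0 => n _.
rewrite -(@ler_pXn2r _ 2) ?nnegrE ?rnorm_ge0 ?mulr_ge0 // pythagoras ?iota_uniq //.
rewrite exprMn mulrC (le_trans _ (ler_wpM2l (sqr_ge0 M) (w_sqr n))) // mulr_sumr.
rewrite ler_sum // => k _; rewrite ler_wpM2r ?sqr_ge0 //.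
by rewrite lerXn2r ?nnegrE ?rnorm_ge0.
Qed.

(** Orthogonality allows no cancellation between terms: a small sum forces
    every coefficient to be small. *)
Lemma oseries_ge a k : bounded_coef a ->
  rnorm (a k) * rnorm (w k) <= rnorm (oseries w a).
Proof.
move=> ba; apply: le_trans (rnorm_partial_sum_le k.+1 ba).
rewrite -(@ler_pXn2r _ 2) ?nnegrE ?rnorm_ge0 ?mulr_ge0 ?rnorm_ge0 //.
rewrite pythagoras ?iota_uniq // big_nat_recr//= exprMn lerDr.
by apply: sumr_ge0 => i _; rewrite mulr_ge0 // sqr_ge0.
Qed.

End OrthogonalSeries.

(** * Poles without finite limit point *)

Section DiscretePoles.
Context {R : realType}.
Variable lam : nat -> R[i].
Hypothesis lam_inj : injective lam.
Hypothesis lam_discrete : forall z, ~ limit_point (range lam) z.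

Lemma rnorm_complex_le (x y : R) : rnorm (x +i* y)%C <= `|x| + `|y|.
Proof.
have -> : (x +i* y)%C = x%:C%C + (0 +i* 1)%C * y%:C%C :> R[i].
  by apply/eqP; rewrite eq_complex /= !mul0r !mulr0 mul1r subrr addr0 !add0r !eqxx.
rewrite (le_trans (rnormD _ _)) // rnormM.
have -> : rnorm (0 +i* 1 : R[i])%C = 1.
  by rewrite /rnorm normc_def /= expr0n /= expr1n add0r sqrtr1.
by rewrite mul1r /rnorm !normc_def /= !expr0n /= !addr0 !sqrtr_sqr.
Qed.

Lemma abs_Re_le (z : R[i]) : `|complex.Re z| <= rnorm z.
Proof. by rewrite -lecR -rnormE normc_ge_Re. Qed.

Lemma abs_Im_le (z : R[i]) : `|complex.Im z| <= rnorm z.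
Proof.
rewrite /rnorm normc_def /= -sqrtr_sqr ler_wsqrtr // lerDr sqr_ge0 //.
Qed.

Lemma compact_complex_square (r : R) :
  compact [set (p.1 +i* p.2)%C | p in `[- r, r]%classic `*` `[- r, r]%classic].
Proof.
apply: continuous_compact; last by apply: compact_setX; exact: segment_compact.
apply/continuous_subspaceT => -[x y]; apply/cvg_rnormP => e e0.
have e2 : 0 < e / 2 by rewrite divr_gt0.
exists (ball x (e / 2), ball y (e / 2)).
  by split; exact: nbhsx_ballx.
move=> [x' y'] /= [xx yy].
rewrite /GRing.add/= (le_lt_trans (rnorm_complex_le _ _)) //.
by rewrite [e]splitr ltrD.
Qed.

(** Otherwise infinitely many poles stay in a disc, which lies in a compact
    square, and a cluster point of them is a limit point of the set of poles
    because lam is injective. *)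
Lemma poles_diverge (r : R) : exists n, forall k, (n <= k)%N -> r < rnorm (lam k).
Proof.
apply: contrapT => /forallNP H.
have {}H n : exists k, (n <= k)%N /\ rnorm (lam k) <= r.
  have /existsNP[k /not_implyP[nk /negP]] := H n.
  by rewrite -leNgt => kr; exists k.
have [f fP] := choice H.
have := @compact_complex_square r ((lam \o f) @ \oo) _.
case=> [|z [_ zc]].
  exists 0 => // n _ /=; exists (complex.Re (lam (f n)), complex.Im (lam (f n))).
    have [_ fr] := fP n.
    split => /=; rewrite in_itv /= -ler_norml.
      exact: le_trans (abs_Re_le _) fr.
    exact: le_trans (abs_Im_le _) fr.
  by rewrite /=; case: (lam (f n)).
apply: (lam_discrete (z := z)) => U zU.
(* By injectivity at most one index has its pole at z. *)
have [n0 n0P] : exists n0, forall n, (n0 <= n)%N -> lam n != z.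
  have [[k0 kz]|/forallNP nz] := pselect (exists k, lam k = z).
    exists k0.+1 => n k0n; rewrite -kz; apply: contraTneq k0n => /lam_inj ->.
    by rewrite ltnn.
  by exists 0 => n _; apply/eqP/nz.
have [] := zc [set lam (f n) | n in [set n | (n0 <= n)%N]] U _ zU.
  by exists n0 => // n n0n; exists n.
move=> y [[n /= n0n <-] Uy]; exists (lam (f n)); split => //.
  by apply: n0P; rewrite (leq_trans n0n) // (fP n).1.
by exists (f n).
Qed.

(** Only finitely many poles are within distance 1 of a bounded set, and
    each of them is at positive distance from the closed set E. *)
Lemma poles_away_from_compact (E : set R[i]) :
  compact E -> (forall k, ~ E (lam k)) ->
  exists2 d : R, 0 < d & forall z k, E z -> d <= rnorm (lam k - z).
Proof.
move=> cE Elam.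
have Ecl : closed E by apply: compact_closed cE; exact: norm_hausdorff.
have [M M0 EM] := compact_rnorm_bounded cE.
have [n nP] := poles_diverge (M + 1).
suff [d d0 dP] : exists2 d : R, 0 < d &
    forall z k, E z -> (k < n)%N -> d <= rnorm (lam k - z).
  exists (Num.min 1 d) => [|z k Ez]; first by rewrite lt_min ltr01.
  have [kn|nk] := ltnP k n; first by rewrite ge_min dP ?orbT.
  rewrite ge_min (le_trans _ (rnormB _ _)) // lerBrDr.
  by rewrite (le_trans _ (ltW (nP k nk))) // addrC lerD2r EM.
elim: n {nP} => [|n [d d0 dP]]; first by exists 1.
have : nbhs (lam n) (~` E).
  by apply: open_nbhs_nbhs; split; [rewrite openC|exact: Elam].
move/nbhs_rnormP => [e e0 eP].
exists (Num.min d e) => [|z k Ez]; first by rewrite lt_min d0.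
rewrite ltnS leq_eqVlt => /predU1P[->|kn]; last by rewrite ge_min dP.
rewrite ge_min orbC leNgt; apply/orP; left; apply/negP => /eP.
exact.
Qed.

Lemma poles_away_from_point z : ~ range lam z ->
  exists2 d : R, 0 < d & forall k, d <= rnorm (lam k - z).
Proof.
move=> zlam; have zE k : ~ [set z] (lam k) by move=> kz; apply: zlam; exists k.
have [d d0 dP] := poles_away_from_compact (@compact_set1 _ z) zE.
by exists d => // k; exact: dP.
Qed.

Lemma open_compl_poles : open (~` range lam).
Proof.
rewrite openE => z /poles_away_from_point[d d0 dP]; apply/nbhs_rnormP.
by exists d => // y zy [k _ ky]; move: zy; rewrite -ky rnormBC ltNge dP.
Qed.

End DiscretePoles.

(** * Complex derivatives of vector-valued functions *)

Section ComplexDerivative.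
Context {R : realType} {V : normedModType R[i]}.
Implicit Types (f g : R[i] -> V) (O : set R[i]) (P : {poly R[i]}).

(** First-order expansion with a relative error, free of division by h, which
    is the form in which series of functions are differentiated below. *)
Definition has_deriv f z (l : V) := forall e : R, 0 < e ->
  exists2 d : R, 0 < d & forall h, rnorm h < d ->
    rnorm (f (h + z) - f z - h *: l) <= e * rnorm h.

Lemma has_deriv_derive1 f z l : has_deriv f z l -> derive1 f z = l.
Proof.
move=> fl; apply: (@norm_cvg_lim _ V); apply/cvg_rnormP => e e0.
have e2 : 0 < e / 2 by rewrite divr_gt0.
have [d d0 dP] := fl _ e2.
apply/nbhs_rnormP; exists d => // h; rewrite sub0r rnormN => hd h0.
have rh0 : 0 < rnorm h by rewrite rnorm_gt0.
have -> : l - h^-1 *: (f (h + z) - f z) =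
          - (h^-1 *: (f (h + z) - f z - h *: l)).
  by rewrite [in RHS]scalerBr scalerA mulVf// scale1r opprB.
rewrite rnormN rnormZ rnormV mulrC ltr_pdivrMr //.
by rewrite (le_lt_trans (dP _ hd)) // ltr_pM2r // ltr_pdivrMr // mulr_natr mulr2n ltrDl.
Qed.

Lemma has_derivD f g z l m : has_deriv f z l -> has_deriv g z m ->
  has_deriv (fun z => f z + g z) z (l + m).
Proof.
move=> fl gm e e0; have e2 : 0 < e / 2 by rewrite divr_gt0.
have [d d0 dP] := fl _ e2; have [d' d'0 d'P] := gm _ e2.
exists (Num.min d d') => [|h]; first by rewrite lt_min d0.
rewrite lt_min => /andP[hd hd'].
have -> : f (h + z) + g (h + z) - (f z + g z) - h *: (l + m) =
    (f (h + z) - f z - h *: l) + (g (h + z) - g z - h *: m).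
  by rewrite scalerDr !opprD [X in X + _ = _]addrACA [LHS]addrACA.
by rewrite (le_trans (rnormD _ _)) // [e]splitr mulrDl lerD ?dP ?d'P.
Qed.

Lemma has_derivZ (c : R[i]) f z l : has_deriv f z l ->
  has_deriv (fun z => c *: f z) z (c *: l).
Proof.
move=> fl e e0; have c1 : 0 < rnorm c + 1 by rewrite ltr_pwDr ?rnorm_ge0.
have [d d0 dP] := fl _ (divr_gt0 e0 c1); exists d => // h hd.
rewrite scalerA [h * c]mulrC -scalerA -!scalerBr rnormZ.
rewrite (le_trans (ler_wpM2l (rnorm_ge0 c) (dP h hd))) //.
rewrite mulrA ler_wpM2r ?rnorm_ge0 // mulrCA ler_piMr ?ltW //.
by rewrite ltr_pdivrMr // mul1r ltrDl.
Qed.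

Lemma has_deriv_cst (c : V) z : has_deriv (fun=> c) z 0.
Proof.
move=> e e0; exists 1 => // h _.
by rewrite subrr scaler0 subrr rnorm0 mulr_ge0 ?rnorm_ge0 // ltW.
Qed.

Lemma has_derivXM f z l : has_deriv f z l ->
  has_deriv (fun z => z *: f z) z (f z + z *: l).
Proof.
move=> fl e e0.
have z1 : 0 < rnorm z + 1 by rewrite ltr_pwDr ?rnorm_ge0.
have l1 : 0 < rnorm l + 1 by rewrite ltr_pwDr ?rnorm_ge0.
have e2 : 0 < e / 2 by rewrite divr_gt0.
have [d d0 dP] := fl _ (divr_gt0 e2 z1).
have [d' d'0 d'P] := fl _ ltr01.
exists (Num.min d (Num.min d' (e / 2 / (rnorm l + 1)))) => [|h].
  by rewrite !lt_min d0 d'0 divr_gt0.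
rewrite !lt_min => /and3P[hd hd' he].
have -> : (h + z) *: f (h + z) - z *: f z - h *: (f z + z *: l) =
   z *: (f (h + z) - f z - h *: l) + h *: (f (h + z) - f z).
  rewrite !scalerDl !scalerDr !scalerN !scalerA [z * h]mulrC.
  by rewrite -[X in X - (_ + _)]addrA opprD addrACA [LHS]addrC.
rewrite (le_trans (rnormD _ _)) // !rnormZ [e]splitr mulrDl lerD //.
  rewrite (le_trans (ler_wpM2l (rnorm_ge0 z) (dP h hd))) //.
  rewrite mulrA ler_wpM2r ?rnorm_ge0 // mulrCA ler_piMr ?ltW //.
  by rewrite ltr_pdivrMr // mul1r ltrDl.
rewrite mulrC ler_wpM2r ?rnorm_ge0 //.
have -> : f (h + z) - f z = (f (h + z) - f z - h *: l) + h *: l by rewrite subrK.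
rewrite (le_trans (rnormD _ _)) // rnormZ.
rewrite (le_trans (lerD (d'P h hd') (lexx _))) //.
by rewrite mul1r -[X in X + _]mulr1 -mulrDr addrC -ler_pdivlMr // ltW.
Qed.

Lemma has_deriv_scaled f P z l : has_deriv f z l ->
  has_deriv (scaled f P) z (scaled f P^`() z + P.[z] *: l).
Proof.
move=> fl; elim/poly_ind: P => [|P c IHP].
  rewrite /scaled deriv0 !horner0 !scale0r addr0.
  by under eq_fun do rewrite horner0 scale0r; exact: has_deriv_cst.
have -> : scaled f (P * 'X + c%:P) = fun z => z *: scaled f P z + c *: f z.
  by apply/funext => x; rewrite /scaled !hornerE scalerDl scalerA [x * _]mulrC.
have := has_derivD (has_derivXM IHP) (has_derivZ c fl).
rewrite /scaled derivD derivM derivX derivC addr0 mulr1 !hornerE.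
rewrite !scalerDl !scalerDr !scalerA ![z * _]mulrC.
by rewrite (addrCA (P.[z] *: f z)) !addrA.
Qed.

(** Iterated derivatives at a point of an open set depend only on the values
    in that set. *)
Lemma derive1n_eq_on O n f g : open O -> (forall z, O z -> f z = g z) ->
  forall z, O z -> derive1n n f z = derive1n n g z.
Proof.
move=> oO fg z Oz; elim: n z Oz => [|n IHn] z Oz; first exact: fg.
rewrite !derive1nS !derive1E; apply: near_eq_derive.
by apply: filterS (open_nbhs_nbhs (conj oO Oz)).
Qed.

(** n-fold differentiability on O, with the successive derivatives prescribed
    on O only: the total function derive1 is uncontrolled elsewhere. *)
Fixpoint smooth O n f := if n is n'.+1 then
  exists2 g, (forall z, O z -> has_deriv f z (g z)) & smooth O n' g else True.

Lemma smoothW O n f : smooth O n.+1 f -> smooth O n f.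
Proof.
by elim: n f => [//|n IHn] f [g fg gn]; exists g => //; exact: IHn.
Qed.

Lemma smoothD O n f g : smooth O n f -> smooth O n g ->
  smooth O n (fun z => f z + g z).
Proof.
elim: n f g => [//|n IHn] f g [f' ff' sf] [g' gg' sg].
by exists (fun z => f' z + g' z) => [z Oz|]; [apply: has_derivD; auto|exact: IHn].
Qed.

Lemma smooth_scaled O n f P : smooth O n f -> smooth O n (scaled f P).
Proof.
elim: n f P => [//|n IHn] f P sf; have [g fg sg] := sf.
exists (fun z => scaled f P^`() z + scaled g P z) => [z Oz|].
  by apply: has_deriv_scaled; auto.
by apply: smoothD; apply: IHn => //; exact: smoothW.
Qed.

Lemma derive1nD O n f g : open O -> smooth O n f -> smooth O n g ->
  forall z, O z ->
  derive1n n (fun z => f z + g z) z = derive1n n f z + derive1n n g z.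
Proof.
move=> oO; elim: n f g => [//|n IHn] f g [f' ff' sf] [g' gg' sg] z Oz.
rewrite !derive1Sn (derive1n_eq_on (g := fun z => f' z + g' z) _ oO) //; last first.
  by move=> x Ox; apply: has_deriv_derive1; apply: has_derivD; auto.
rewrite (derive1n_eq_on (f := derive1 f) (g := f') _ oO) //; last first.
  by move=> x Ox; apply: has_deriv_derive1; auto.
rewrite (derive1n_eq_on (f := derive1 g) (g := g') _ oO) //; first exact: IHn.
by move=> x Ox; apply: has_deriv_derive1; auto.
Qed.

(** Each differentiation of P f lowers the multiplicity of the zero of P at x
    by at most one. With P the nodal polynomial, this is why the error of the
    interpolant satisfies the Hermite conditions at repeated nodes. *)
Lemma derive1n_scaled_eq0 O n f P x r : open O -> O x -> smooth O n f ->
  (('X - x%:P) ^+ r %| P)%R -> (n < r)%N -> derive1n n (scaled f P) x = 0.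
Proof.
move=> oO Ox; elim: n f P r => [|n IHn] f P [//|r] sf xP nr.
  rewrite /derive1n /= /scaled; have -> : P.[x] = 0; last by rewrite scale0r.
  by apply/eqP; rewrite -[_ == _]/(root P x) -dvdp_XsubCl (dvdp_trans _ xP)// exprS dvdp_mulr.
have [g fg sg] := sf.
have xP' : (('X - x%:P) ^+ r %| P)%R.
  by apply: dvdp_trans xP; exact: dvdp_exp2l.
rewrite derive1Sn (derive1n_eq_on
  (g := fun z => scaled f P^`() z + scaled g P z) _ oO) //; last first.
  by move=> z Oz; apply: has_deriv_derive1; apply: has_deriv_scaled; auto.
rewrite (derive1nD oO) //; first last.
- exact: smooth_scaled.
- by apply: smooth_scaled; exact: smoothW.
rewrite (IHn g _ r) // addr0 (IHn f _ r) //; first exact: smoothW.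
case/dvdpP: xP => q ->; rewrite derivM deriv_exp derivXsubC mul1r.
apply: dvdp_add; first by rewrite dvdp_mull // dvdp_exp2l.
by rewrite dvdp_mull // -scaler_nat dvdpZr ?pnatr_eq0 //= dvdpp.
Qed.

End ComplexDerivative.

(** * Series of Cauchy kernels *)

Section CauchySeries.
Context {R : realType} {V : completeNormedModType R[i]}.
Variable dot : {dot V for (@Num.conj R[i])}.
Hypothesis dot_norm : forall x : V, dot x x = `|x| ^+ 2.
Variables (w : nat -> V) (B : R).
Hypothesis w_orth : forall i j, i != j -> dot (w i) (w j) = 0.
Hypothesis B_ge0 : 0 <= B.
Hypothesis w_sqr : forall n, \sum_(0 <= k < n) rnorm (w k) ^+ 2 <= B ^+ 2.
Variable lam : nat -> R[i].
Hypothesis lam_inj : injective lam.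
Hypothesis lam_discrete : forall z, ~ limit_point (range lam) z.
Implicit Types a : nat -> R[i].

(** For m = 1 this is a function with simple poles at the lam k and residues
    proportional to a k *: w k; the powers m > 1 occur in its derivatives. *)
Definition cauchy_series m a (z : R[i]) : V :=
  oseries w (fun k => a k * (lam k - z)^-1 ^+ m).

Lemma bounded_coef_resolvent z : ~ range lam z ->
  bounded_coef (fun k => (lam k - z)^-1).
Proof.
move=> /(poles_away_from_point lam_inj lam_discrete)[d d0 dP].
exists d^-1 => k; rewrite rnormV lef_pV2 ?posrE //.
exact: lt_le_trans (dP k).
Qed.

Lemma bounded_coef_cauchy m a z : bounded_coef a -> ~ range lam z ->
  bounded_coef (fun k => a k * (lam k - z)^-1 ^+ m).
Proof.
move=> ba zlam; apply: bounded_coefM => //; apply: bounded_coefX.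
exact: bounded_coef_resolvent.
Qed.

(** The relation between x and y is the resolvent identity satisfied by
    x = 1 / (l - z) and y = 1 / (l - (h + z)). The constant depends on the bound A
    only, hence the expansion is uniform over all poles l. *)
Lemma resolvent_taylor_bound m (A : R) : exists2 C : R, 0 <= C &
  forall x y h : R[i], rnorm x <= A -> rnorm y <= A -> y = x + h * (x * y) ->
    rnorm (y ^+ m - x ^+ m - h * (m%:R * x ^+ m.+1)) <= C * rnorm h ^+ 2.
Proof.
elim: m => [|m [C C0 IHm]].
  by exists 0 => // x y h _ _ _; rewrite !expr0 subrr mul0r mulr0 subrr rnorm0 mul0r.
exists (`|A| * C + m.+1%:R * `|A| ^+ m.+3).
  by rewrite addr_ge0 // mulr_ge0 // exprn_ge0.
move=> x y h xA yA yE.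
have AA : A <= `|A| by exact: ler_norm.
have -> : y ^+ m.+1 - x ^+ m.+1 - h * (m.+1%:R * x ^+ m.+2) =
    y * (y ^+ m - x ^+ m - h * (m%:R * x ^+ m.+1)) +
    h ^+ 2 * (m.+1%:R * (x ^+ m.+2 * y)).
  have -> : y ^+ m.+1 = y * y ^+ m by rewrite exprS.
  have E : y * x ^+ m = x ^+ m.+1 + h * (x ^+ m.+1 * y).
    by rewrite {1}yE exprS; ring.
  have E' : h * x ^+ m.+1 * y = h * x ^+ m.+2 + h ^+ 2 * (x ^+ m.+2 * y).
    by rewrite {1}yE !exprS; ring.
  rewrite !mulrBr E.
  have -> : y * (h * (m%:R * x ^+ m.+1)) = m%:R * (h * x ^+ m.+1 * y) by ring.
  have -> : h * (x ^+ m.+1 * y) = h * x ^+ m.+1 * y by ring.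
  rewrite E' -[m.+1]addn1 natrD; ring.
rewrite (le_trans (rnormD _ _)) // mulrDl lerD //.
  rewrite rnormM -mulrA ler_pM ?rnorm_ge0 ?(le_trans yA) //.
  exact: IHm.
rewrite rnormM rnormX mulrC ler_wpM2r ?sqr_ge0 // rnormM [X in _ * X]rnormM rnormX.
have -> : rnorm (m.+1%:R : R[i]) = m.+1%:R.
  by rewrite -[_%:R](rmorph_nat (real_complex R)) rnorm_real.
rewrite ler_wpM2l // [X in _ <= X]exprSr ler_pM ?exprn_ge0 ?rnorm_ge0 ?(le_trans yA) //.
by rewrite lerXn2r ?nnegrE ?rnorm_ge0 // (le_trans xA).
Qed.

(** Termwise differentiation: the sequence of second-order remainders is
    bounded uniformly over the poles, and oseries is continuous for the sup norm. *)
Lemma has_deriv_cauchy_series m a z : bounded_coef a -> ~ range lam z ->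
  has_deriv (cauchy_series m a) z (m%:R *: cauchy_series m.+1 a z).
Proof.
move=> ba zlam.
have [d d0 dP] := poles_away_from_point lam_inj lam_discrete zlam.
have [C C0 CP] := resolvent_taylor_bound m (d / 2)^-1.
have [M aM] := ba.
have M0 : 0 <= M by exact: le_trans (rnorm_ge0 _) (aM 0).
have BMC : 0 < B * (M * C) + 1 by rewrite ltr_pwDr // !mulr_ge0.
have d2 : 0 < d / 2 by rewrite divr_gt0.
move=> e e0.
exists (Num.min (d / 2) (e / (B * (M * C) + 1))) => [|h].
  by rewrite lt_min d2 divr_gt0.
rewrite lt_min => /andP[hd he].
have hP k : d / 2 <= rnorm (lam k - (h + z)).
  rewrite opprD addrCA addrC (le_trans _ (rnormB _ _)) //.
  by rewrite lerBrDr (le_trans _ (dP k)) // [leRHS]splitr lerD2l ltW.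
have hzlam : ~ range lam (h + z).
  by move=> [k _ kz]; move: (hP k); rewrite kz subrr rnorm0 leNgt d2.
have bx := bounded_coef_cauchy m ba zlam.
have by_ := bounded_coef_cauchy m ba hzlam.
have bx' := bounded_coef_cauchy m.+1 ba zlam.
rewrite /cauchy_series scalerA -(oseriesZ dot_norm w_orth w_sqr (h * m%:R) bx').
have bhx := bounded_coefM (bounded_coefC (h * m%:R)) bx'.
rewrite -!(oseriesB dot_norm w_orth w_sqr) //; last exact: bounded_coefB.
apply: (le_trans (oseries_bound dot_norm w_orth B_ge0 w_sqr (M := M * (C * rnorm h ^+ 2)) _)).
  move=> k.
  set x := (lam k - z)^-1; set y := (lam k - (h + z))^-1.
  have -> : a k * y ^+ m - a k * x ^+ m - h * m%:R * (a k * x ^+ m.+1) =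
    a k * (y ^+ m - x ^+ m - h * (m%:R * x ^+ m.+1)) by ring.
  rewrite rnormM ler_pM ?rnorm_ge0 // CP //.
  - rewrite rnormV lef_pV2 ?posrE //; last by apply: lt_le_trans (dP k).
    by rewrite (le_trans _ (dP k)) // ler_pdivrMr // ler_peMr ?ler1n // ltW.
  - by rewrite rnormV lef_pV2 ?posrE //; apply: lt_le_trans (hP k).
  - rewrite /x /y; field.
    rewrite -!rnorm_gt0 (lt_le_trans d0 (dP k)) /=.
    by rewrite (lt_le_trans d2 (hP k)).
move: he; rewrite ltr_pdivlMr // => he.
rewrite expr2 !mulrA ler_wpM2r ?rnorm_ge0 //.
rewrite (le_trans _ (ltW he)) // mulrC ler_wpM2l ?rnorm_ge0 //.
by rewrite -!mulrA lerDl.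
Qed.

Lemma smooth_cauchy_series n m a : bounded_coef a ->
  smooth (~` range lam) n (cauchy_series m a).
Proof.
move=> ba; elim: n m => [//|n IHn] m.
exists (scaled (cauchy_series m.+1 a) m%:R%:P) => [z zlam|].
  by rewrite /scaled hornerC; exact: has_deriv_cauchy_series.
exact: smooth_scaled.
Qed.

End CauchySeries.

(** * Uniqueness of Hermite interpolants *)

Section HermiteUniqueness.
Context {F : numFieldType}.
Implicit Types (p q r : {poly F}).

(** The first possibly nonzero derivative at a zero of multiplicity at least j. *)
Lemma horner_derivn_XsubC_exp r x j :
  (r * ('X - x%:P) ^+ j)^`(j).[x] = r.[x] *+ j`!.
Proof.
elim: j r => [|j IHj] r; first by rewrite expr0 mulr1 derivn0 mulr1n.
rewrite derivSn derivM deriv_exp derivXsubC mul1r.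
have -> : r^`() * ('X - x%:P) ^+ j.+1 + r * (('X - x%:P) ^+ j *+ j.+1) =
   (r^`() * ('X - x%:P) + r *+ j.+1) * ('X - x%:P) ^+ j.
  by rewrite [RHS]mulrDl -mulrA -exprS mulrnAr mulrnAl.
rewrite IHj hornerD hornerM hornerXsubC subrr mulr0 add0r hornerMn -mulrnA.
by rewrite factS.
Qed.

Lemma dvdp_XsubC_exp q x m :
  (forall k, (k < m)%N -> q^`(k).[x] = 0) -> (('X - x%:P) ^+ m %| q)%R.
Proof.
elim: m => [_|m IHm H]; first by rewrite expr0 dvd1p.
have /dvdpP[r rE] : (('X - x%:P) ^+ m %| q)%R by apply: IHm => k /ltnW; exact: H.
have /eqP := H m (leqnn _).
rewrite rE horner_derivn_XsubC_exp mulrn_eq0 gtn_eqF ?fact_gt0 //= => rx.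
by rewrite exprS dvdp_mul // dvdp_XsubCl.
Qed.

Lemma dvdp_prod_XsubC_exp (s : seq F) (m : F -> nat) q : uniq s ->
  (forall x, x \in s -> (('X - x%:P) ^+ m x %| q)%R) ->
  (\prod_(x <- s) ('X - x%:P) ^+ m x %| q)%R.
Proof.
elim: s => [|x s IHs] /=; first by rewrite big_nil dvd1p.
move=> /andP[xs us] H; rewrite big_cons Gauss_dvdp.
  by rewrite H ?mem_head // IHs // => y ys; rewrite H // inE ys orbT.
rewrite coprimep_expl // coprimep_sym coprimep_XsubC /root horner_prod.
rewrite prodf_seq_neq0; apply/allP => y ys /=.
rewrite horner_exp hornerXsubC expf_neq0 // subr_eq0.
by apply: contraNneq xs => ->.
Qed.

(** Vanishing to the order of each node makes q divisible by the nodal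
    polynomial, whose degree is too large unless q = 0. *)
Lemma hermite_scalar_unique (X : seq F) q : (size q <= size X)%N ->
  (forall x k, (k < count_mem x X)%N -> q^`(k).[x] = 0) -> q = 0.
Proof.
move=> qX H; apply/eqP; apply: contraLR qX => q0; rewrite -ltnNge.
have : (\prod_(x <- X) ('X - x%:P) %| q)%R.
  rewrite -prodr_undup_exp_count; apply: dvdp_prod_XsubC_exp; first exact: undup_uniq.
  by move=> x _; apply: dvdp_XsubC_exp => k; exact: H.
by move/(dvdp_leq q0); rewrite size_prod_XsubC.
Qed.

End HermiteUniqueness.

Section VectorPolynomials.
Context {R : realType} {V : normedModType R[i]}.
Implicit Types (c : nat -> V).

Definition vpoly c n (z : R[i]) : V := \sum_(i < n) z ^+ i *: c i.

(** Coefficients of the derivative of the polynomial with coefficients c. *)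
Definition vderiv c i : V := i.+1%:R *: c i.+1.

Lemma has_deriv_vpoly c n z :
  has_deriv (vpoly c n) z (vpoly (vderiv c) n.-1 z).
Proof.
elim: n => [|n IHn].
  rewrite /vpoly big_ord0; have -> : (fun z => \sum_(i < 0) z ^+ i *: c i) = fun=> 0.
    by apply/funext => x; rewrite big_ord0.
  exact: has_deriv_cst.
have -> : vpoly c n.+1 = fun z => vpoly c n z + scaled (fun=> c n) 'X^n z.
  by apply/funext => x; rewrite /vpoly big_ord_recr /= /scaled hornerXn.
have := has_derivD IHn (has_deriv_scaled 'X^n (has_deriv_cst (c n) z)).
rewrite /scaled scaler0 addr0 derivXn hornerMn hornerXn.
case: n {IHn} => [|n] /=; first by rewrite mulr0n scale0r addr0.
have -> : vpoly (vderiv c) n.+1 z = vpoly (vderiv c) n z + z ^+ n *: vderiv c n.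
  by rewrite /vpoly big_ord_recr.
by rewrite /vderiv scalerA mulr_natr.
Qed.

Lemma smooth_vpoly O m c n : smooth O m (vpoly c n).
Proof.
elim: m c n => [//|m IHm] c n; exists (vpoly (vderiv c) n.-1) => [z _|//].
exact: has_deriv_vpoly.
Qed.

Lemma derive1n_vpoly k c n :
  derive1n k (vpoly c n) = vpoly (iter k vderiv c) (n - k).
Proof.
elim: k c n => [|k IHk] c n; first by rewrite subn0.
rewrite derive1Sn.
have -> : derive1 (vpoly c n) = vpoly (vderiv c) n.-1.
  by apply/funext => z; apply: has_deriv_derive1; exact: has_deriv_vpoly.
by rewrite IHk iterSr -subn1 -subnDA add1n.
Qed.

Lemma iter_vderivE k c i : iter k vderiv c i = ((i + k) ^_ k)%:R *: c (i + k)%N.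
Proof.
elim: k i => [|k IHk] i; first by rewrite addn0 ffactn0 scale1r.
rewrite iterS /vderiv IHk scalerA addSn addnS ffactnSr -natrM mulnC.
by rewrite -addSn addnK.
Qed.

(** The functional jfun reads off the coefficient of top degree. *)
Lemma derive1n_vpoly_lead c n : derive1n n (vpoly c n.+1) 0 = n`!%:R *: c n.
Proof.
rewrite derive1n_vpoly subSnn /vpoly big_ord1 expr0 scale1r iter_vderivE.
by rewrite add0n ffactnn.
Qed.

Variable dot : {dot V for (@Num.conj R[i])}.

Lemma dot_vpoly c n (z : R[i]) (x : V) :
  dot (vpoly c n z) x = (\poly_(i < n) dot (c i) x).[z].
Proof.
rewrite horner_poly /vpoly; elim: n => [|n IHn].
  by rewrite !big_ord0 linear0l.
by rewrite !big_ord_recr /= linearDl /= IHn linearZl_LR /= mulrC.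
Qed.

Lemma derivn_dot_vpoly k c n (x : V) :
  (\poly_(i < n) dot (c i) x)^`(k) =
  \poly_(i < n - k) dot (iter k vderiv c i) x.
Proof.
elim: k c n => [|k IHk] c n; first by rewrite subn0 derivn0.
rewrite derivSn iterSr subnS -subn1 subnAC subn1 -IHk; congr (_^`(k)).
apply/polyP => i; rewrite coef_deriv !coef_poly /vderiv linearZl_LR /=.
rewrite -ltn_predRL; case: ifP => _; first by rewrite mulr_natl.
by rewrite mul0rn.
Qed.

(** Testing against a vector x turns the vector-valued polynomial into a scalar
    one with coefficients dot (c i) x; taking x = c i then shows c i = 0. *)
Lemma vpoly_hermite_unique (X : seq R[i]) c :
  (forall x k, (k < count_mem x X)%N -> derive1n k (vpoly c (size X)) x = 0) ->
  forall i, (i < size X)%N -> c i = 0.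
Proof.
move=> H i iX; apply/eqP; rewrite -(dnorm_eq0 dot); apply/eqP.
have P0 : \poly_(j < size X) dot (c j) (c i) = 0.
  apply: (@hermite_scalar_unique _ X); first exact: size_poly.
  move=> x k kX; rewrite derivn_dot_vpoly -dot_vpoly -derive1n_vpoly.
  by rewrite H // linear0l.
by have := congr1 (fun p : {poly _} => p`_i) P0; rewrite coef_poly iX coef0.
Qed.

End VectorPolynomials.

(** * The Hermite interpolant of the scaled target map *)

Section NodalPolynomial.
Context {R : realType}.
Implicit Types (X : seq R[i]) (Q : {poly R[i]}).

Definition nodal_poly X : {poly R[i]} := \prod_(x <- X) ('X - x%:P).

Lemma nodalE X z : nodal X z = (nodal_poly X).[z].
Proof.
by rewrite /nodal horner_prod; apply: eq_bigr => x _; rewrite hornerXsubC.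
Qed.

Lemma dvdp_nodal_poly X x :
  (('X - x%:P) ^+ count_mem x X %| nodal_poly X)%R.
Proof.
elim: X => [|y X IHX]; rewrite /nodal_poly ?big_nil ?dvdp1 ?size_poly1// big_cons.
by rewrite /= exprD dvdp_mul //; case: eqP => [->|_]; rewrite ?expr1 ?dvdpp ?expr0 ?dvd1p.
Qed.

Lemma seq_rnorm_bounded X : exists r : R, forall x, x \in X -> rnorm x <= r.
Proof.
elim: X => [|y X [r IHX]]; first by exists 0.
exists (Num.max (rnorm y) r) => x; rewrite inE le_max => /predU1P[->|/IHX ->].
  by rewrite lexx.
by rewrite orbT.
Qed.

(** Far from a disc containing the nodes, each factor is at least the distance
    to the disc. No potential theory is needed for the poles near infinity. *)
Lemma rnorm_nodal_ge X (r : R) z : (forall x, x \in X -> rnorm x <= r) ->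
  r <= rnorm z -> (rnorm z - r) ^+ size X <= rnorm (nodal X z).
Proof.
move=> Xr rz; rewrite /nodal rnorm_prod; elim: X Xr => [|x X IHX] Xr.
  by rewrite big_nil expr0.
rewrite big_cons exprS ler_pM ?exprn_ge0 ?subr_ge0 //.
  by rewrite (le_trans _ (rnormB _ _)) // lerB // Xr // mem_head.
by apply: IHX => y yX; rewrite Xr // inE yX orbT.
Qed.

Lemma rnorm_horner_le Q n z : (size Q <= n.+1)%N -> 1 <= rnorm z ->
  rnorm Q.[z] <= (\sum_(i < n.+1) rnorm Q`_i) * rnorm z ^+ n.
Proof.
move=> Qn z1; rewrite (horner_coef_wide _ Qn) mulr_suml.
rewrite (le_trans (rnorm_sum _ _ _)) // ler_sum // => i _.
rewrite rnormM rnormX ler_wpM2l ?rnorm_ge0 // ler_weXn2l //.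
by rewrite -ltnS.
Qed.

End NodalPolynomial.

Section Interpolant.
Context {R : realType} {V : completeNormedModType R[i]}.
Variable dot : {dot V for (@Num.conj R[i])}.
Hypothesis dot_norm : forall x : V, dot x x = `|x| ^+ 2.
Variables (w : nat -> V) (B : R).
Hypothesis w_orth : forall i j, i != j -> dot (w i) (w j) = 0.
Hypothesis B_ge0 : 0 <= B.
Hypothesis w_sqr : forall n, \sum_(0 <= k < n) rnorm (w k) ^+ 2 <= B ^+ 2.
Variable lam : nat -> R[i].
Hypothesis lam_inj : injective lam.
Hypothesis lam_discrete : forall z, ~ limit_point (range lam) z.
Variable u : R[i] -> V.
Hypothesis uE : forall z, ~ range lam z -> u z = cauchy_series w lam 1 (fun=> 1) z.
Variables (X : seq R[i]) (Q : {poly R[i]}).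
Hypothesis X_lam : forall x, x \in X -> ~ range lam x.
Hypothesis QX : (size Q <= size X)%N.

(** Both the leading coefficient of the interpolant of Q / (lam k - z) and the
    scalar factor in its error. *)
Definition residue_ratio k : R[i] := Q.[lam k] / nodal X (lam k).
Local Notation a := residue_ratio.
Local Notation W := (nodal_poly X).

Lemma nodal_pole_neq0 k : nodal X (lam k) != 0.
Proof.
rewrite /nodal prodf_seq_neq0; apply/allP => x xX /=.
by rewrite subr_eq0; apply/eqP => kx; apply: (X_lam xX); exists k.
Qed.

(** The degree of Q is at most that of the nodal polynomial, so the ratio is
    bounded at infinity. *)
Lemma bounded_residue_ratio : bounded_coef a.
Proof.
apply: bounded_coef_near.
have [r Xr] := seq_rnorm_bounded X.
have [n nP] := poles_diverge lam_inj lam_discrete (Num.max 1 (2 * Num.max 0 r)).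
have QX1 : (size Q <= (size X).+1)%N by exact: leqW.
exists n; exists ((\sum_(i < (size X).+1) rnorm Q`_i) * 2 ^+ size X) => k /nP.
rewrite gt_max => /andP[/ltW k1 k2].
have k0 : 0 < rnorm (lam k) by apply: lt_le_trans k1.
rewrite rnormM rnormV ler_pdivrMr ?rnorm_gt0 ?nodal_pole_neq0 //.
rewrite (le_trans (rnorm_horner_le QX1 k1)) // -mulrA ler_wpM2l ?sumr_ge0 //.
  by move=> i _; exact: rnorm_ge0.
have Xr' x : x \in X -> rnorm x <= Num.max 0 r by move=> /Xr; rewrite le_max orbC => ->.
have r0 : 0 <= Num.max 0 r by rewrite le_max lexx.
have rk : Num.max 0 r <= rnorm (lam k).
  by rewrite (le_trans _ (ltW k2)) // ler_peMl // ler1n.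
rewrite (le_trans _ (ler_wpM2l _ (rnorm_nodal_ge Xr' rk))) ?exprn_ge0 //.
rewrite -exprMn lerXn2r ?nnegrE ?mulr_ge0 ?subr_ge0 ?rnorm_ge0 //.
by move: k2; lra.
Qed.

(** The interpolant at X of the scalar function Q(z) / (lam k - z). *)
Definition pole_interpolant k : {poly R[i]} :=
  ((a k *: W - Q) %/ ('X - (lam k)%:P))%R.
Local Notation D := pole_interpolant.

Lemma pole_interpolantE k : D k * ('X - (lam k)%:P) = a k *: W - Q.
Proof.
rewrite divpK // dvdp_XsubCl /root hornerD hornerN hornerZ -nodalE.
by rewrite divfK ?subrr // nodal_pole_neq0.
Qed.

Lemma size_pole_interpolant k : (size (D k) <= size X)%N.
Proof.
rewrite size_divp ?polyXsubC_eq0 // size_XsubC subn1 /=.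
rewrite -subn1 leq_subLR add1n (leq_trans (size_polyD _ _)) // size_polyN geq_max.
by rewrite (leq_trans (size_scale_leq _ _)) ?size_prod_XsubC // leqW.
Qed.

Lemma coef_pole_interpolant k i :
  (if i is j.+1 then (D k)`_j else 0) - (D k)`_i * lam k = a k * W`_i - Q`_i.
Proof.
have := congr1 (fun p : {poly _} => p`_i) (pole_interpolantE k).
by rewrite mulrBr !coefB coefMX coefMC coefZ; case: i.
Qed.

Lemma lead_pole_interpolant k S : size X = S.+1 -> (D k)`_S = a k.
Proof.
move=> XS; have := coef_pole_interpolant k S.+1.
have -> : (D k)`_S.+1 = 0 by rewrite nth_default // -XS size_pole_interpolant.
have -> : Q`_S.+1 = 0 by rewrite nth_default // -XS.
have -> : W`_S.+1 = 1.
  have /monicP := monic_prod_XsubC X xpredT id.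
  by rewrite lead_coefE size_prod_XsubC XS.
by rewrite mul0r !subr0 mulr1.
Qed.

(** Boundedness in k allows the coefficients to be summed against w. Solving
    the recursion upwards from degree 0 divides by lam k at each step, which is
    harmless as |lam k| tends to infinity; solving it downwards from the leading
    coefficient would multiply by lam k. *)
Lemma bounded_coef_pole_interpolant i : bounded_coef (fun k => (D k)`_i).
Proof.
have bM b : bounded_coef (fun k => b k * lam k) -> bounded_coef b.
  move=> [M bM]; apply: bounded_coef_near.
  have [n nP] := poles_diverge lam_inj lam_discrete 1.
  exists n; exists M => k /nP k1; rewrite (le_trans _ (bM k)) // rnormM.
  by rewrite ler_peMr ?rnorm_ge0 // ltW.
have bW j : bounded_coef (fun k => a k * W`_j - Q`_j).
  apply: bounded_coefB; last exact: bounded_coefC.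
  by apply: bounded_coefM; [exact: bounded_residue_ratio|exact: bounded_coefC].
elim: i => [|i IHi]; apply: bM.
  have -> : (fun k => (D k)`_0 * lam k) = fun k => 0 - (a k * W`_0 - Q`_0).
    by apply/funext => k; rewrite -coef_pole_interpolant subKr.
  by apply: bounded_coefB => //; exact: bounded_coefC.
have -> : (fun k => (D k)`_i.+1 * lam k) =
    fun k => (D k)`_i - (a k * W`_i.+1 - Q`_i.+1).
  by apply/funext => k; rewrite -coef_pole_interpolant subKr.
exact: bounded_coefB.
Qed.

Definition interpolant_coef i : V := oseries w (fun k => (D k)`_i).

Lemma vpoly_interpolantE z :
  vpoly interpolant_coef (size X) z = oseries w (fun k => (D k).[z]).
Proof.
under [in RHS]eq_fun do rewrite (horner_coef_wide _ (size_pole_interpolant _)).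
rewrite (oseries_sum dot_norm w_orth w_sqr); last first.
  move=> i; apply: bounded_coefM; last exact: bounded_coefC.
  exact: bounded_coef_pole_interpolant.
apply: eq_bigr => i _; rewrite /interpolant_coef.
rewrite -(oseriesZ dot_norm w_orth w_sqr _ (bounded_coef_pole_interpolant i)).
by congr (oseries w _); apply/funext => k; rewrite mulrC.
Qed.

(** Sum over k of the identity
    pole_interpolant k (z) = (Q(z) - a k W(z)) / (lam k - z). *)
Lemma interpolation_remainder z : ~ range lam z ->
  vpoly interpolant_coef (size X) z + scaled (cauchy_series w lam 1 a) W z =
  scaled u Q z.
Proof.
move=> zlam; rewrite vpoly_interpolantE /scaled uE // /cauchy_series.
have b1 := bounded_coef_cauchy lam_inj lam_discrete 1 (bounded_coefC 1) zlam.
have ba := bounded_coef_cauchy lam_inj lam_discrete 1 bounded_residue_ratio zlam.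
rewrite -(oseriesZ dot_norm w_orth w_sqr _ b1).
rewrite -(oseriesZ dot_norm w_orth w_sqr _ ba).
have bWa := bounded_coefM (bounded_coefC W.[z]) ba.
have bQ1 := bounded_coefM (bounded_coefC Q.[z]) b1.
have DE : (fun k => (D k).[z]) = fun k => Q.[z] * (1 * (lam k - z)^-1 ^+ 1)
   - W.[z] * (a k * (lam k - z)^-1 ^+ 1).
  apply/funext => k; have := congr1 (fun p => p.[z]) (pole_interpolantE k).
  rewrite hornerM hornerXsubC hornerD hornerN hornerZ => E.
  have zk : lam k - z != 0.
    by rewrite subr_eq0; apply/eqP => kz; apply: zlam; exists k.
  apply: (mulIf zk); rewrite mulrBl !expr1 mul1r -!mulrA mulVf // !mulr1.
  by rewrite -opprB mulrN E opprB [a k * _]mulrC.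
rewrite DE (oseriesB dot_norm w_orth w_sqr) // subrK //.
Qed.

(** By the remainder formula the candidate differs from the scaled target map
    by a smooth function times the nodal polynomial; uniqueness does the rest. *)
Lemma interpolateE :
  interpolate X (scaled u Q) = vpoly interpolant_coef (size X).
Proof.
apply: xget_subset1 => [|p q [[c ->] pu] [[d ->] qu]].
  split; first by exists interpolant_coef.
  move=> x k kX; have xX : x \in X by rewrite -has_pred1 has_count (leq_ltn_trans _ kX).
  have oO := open_compl_poles lam_inj lam_discrete.
  have xO := X_lam xX.
  have sm : smooth (~` range lam) k (cauchy_series w lam 1 a).
    apply: (smooth_cauchy_series dot_norm w_orth B_ge0 w_sqr) => //.
    exact: bounded_residue_ratio.
  rewrite -(derive1n_eq_on k oO interpolation_remainder xO).
  rewrite (derive1nD oO) //; [|exact: smooth_vpoly|exact: smooth_scaled].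
  by rewrite (derive1n_scaled_eq0 oO xO sm (dvdp_nodal_poly X x) kX) addr0.
(* The difference of two interpolants has vanishing Hermite data. *)
have cd i : (i < size X)%N -> c i - d i = 0.
  apply: (vpoly_hermite_unique (c := fun i => c i - d i) dot) => x k kX.
  apply: (addIr (derive1n k (vpoly d (size X)) x)).
  rewrite add0r -(derive1nD (O := setT) openT) //; try exact: smooth_vpoly.
  rewrite qu // -pu //; congr (derive1n k _ x); apply/funext => z.
  rewrite /vpoly -big_split /=; apply: eq_bigr => j _.
  by rewrite -scalerDr subrK.
apply/funext => z; apply: eq_bigr => i _; congr (_ *: _).
by apply/eqP; rewrite -subr_eq0 cd.
Qed.

(** The whole dependence on the nodes outside the factor nodal X z sits in the
    residue ratios, whose sum is controlled by jfun. *)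
Lemma interpolation_error z : ~ range lam z ->
  scaled u Q z - interpolate X (scaled u Q) z =
  nodal X z *: cauchy_series w lam 1 a z.
Proof.
move=> zlam; rewrite interpolateE -(interpolation_remainder zlam) /scaled nodalE.
by rewrite addrAC subrr add0r.
Qed.

(** The leading coefficients of the pole interpolants are the residue ratios. *)
Lemma jfunE : X != [::] -> jfun u X Q = rnorm (oseries w a).
Proof.
rewrite -size_eq0 /jfun interpolateE; case XS : (size X) => [//|S] _ /=.
rewrite derive1n_vpoly_lead scalerA mulVf ?scale1r; last first.
  by rewrite pnatr_eq0 -lt0n fact_gt0.
rewrite /interpolant_coef; congr (rnorm (oseries w _)).
by apply/funext => k; exact: lead_pole_interpolant.
Qed.

End Interpolant.

(** * Sizes of the nodal polynomials *)

Section Eventually.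

Lemma eventually_forall_lt n (P : nat -> nat -> Prop) :
  (forall k, (k < n)%N -> exists S0, forall S, (S0 <= S)%N -> P k S) ->
  exists S0, forall S, (S0 <= S)%N -> forall k, (k < n)%N -> P k S.
Proof.
elim: n => [|n IHn] H; first by exists 0%N.
have [S1 H1] := IHn (fun k kn => H k (ltnW kn)).
have [S2 H2] := H n (ltnSn n).
exists (maxn S1 S2) => S; rewrite geq_max => /andP[S1S S2S] k.
by rewrite ltnS leq_eqVlt => /predU1P[->|]; [exact: H2|exact: H1].
Qed.

Lemma geometric_eventually_le {R : realType} (q e : R) : 0 <= q -> q < 1 ->
  0 < e -> exists S0, forall S, (S0 <= S)%N -> q ^+ S <= e.
Proof.
move=> q0 q1 e0; have : `|q| < 1 by rewrite ger0_norm.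
move=> /cvg_expr/cvgrPdist_lt/(_ e e0)[S0 _ H]; exists S0 => S /H /=.
by rewrite sub0r normrN ger0_norm ?exprn_ge0 // => /ltW.
Qed.

End Eventually.

Section NodalRoot.
Context {R : realType}.
Variable Xi : nat -> seq R[i].

Lemma nodal_rootK S z : (0 < S)%N ->
  nodal_root Xi S z ^+ S = rnorm (nodal (Xi S) z).
Proof.
move=> S0; rewrite -powR_mulrn ?powR_ge0 // /nodal_root -powRrM mulVf.
  by rewrite powRr1 // rnorm_ge0.
by rewrite pnatr_eq0 -lt0n.
Qed.

Lemma nodal_root_le S z (t : R) : (0 < S)%N ->
  nodal_root Xi S z <= t -> rnorm (nodal (Xi S) z) <= t ^+ S.
Proof.
move=> S0 zt; rewrite -nodal_rootK // lerXn2r ?nnegrE ?powR_ge0 //.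
exact: le_trans (powR_ge0 _ _) zt.
Qed.

Lemma nodal_root_ge S z (t : R) : (0 < S)%N -> 0 <= t ->
  t <= nodal_root Xi S z -> t ^+ S <= rnorm (nodal (Xi S) z).
Proof.
by move=> S0 t0 zt; rewrite -nodal_rootK // lerXn2r ?nnegrE ?powR_ge0.
Qed.

End NodalRoot.

(** * The parameter set and its potential *)

Section ParameterSetShape.
Context {R : realType}.
Implicit Types K : set R[i].

Lemma line_segment_compact K : line_segment K -> compact K.
Proof.
move=> [a [b [_ ->]]].
apply: continuous_compact; last exact: segment_compact.
apply/continuous_subspaceT => t; apply/cvg_rnormP => e e0.
have ab : 0 < rnorm (b - a) + 1 by rewrite ltr_pwDr ?rnorm_ge0.
have : nbhs t (ball t (e / (rnorm (b - a) + 1))).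
  by apply: nbhsx_ballx; rewrite divr_gt0.
apply: filterS => s; rewrite /ball /= => ts.
have -> : a + t%:C%C * (b - a) - (a + s%:C%C * (b - a)) = (t - s)%:C%C * (b - a).
  by rewrite rmorphB /= mulrBl opprD addrACA subrr add0r.
rewrite rnormM (_ : rnorm (t - s)%:C%C = `|t - s|); last first.
  by rewrite /rnorm normc_def /= expr0n addr0 sqrtr_sqr.
move: ts; rewrite ltr_pdivlMr //; apply: le_lt_trans.
by rewrite ler_wpM2l // lerDl.
Qed.

Lemma closed_jordan_region_bounded K : closed_jordan_region K ->
  closed K /\ exists r : R, forall z, K z -> rnorm z <= r.
Proof.
move=> [J [D [_ _ [M [Mreal MD]] ->]]]; split; first exact: closed_closure.
have /MD DM : M < M + 1 by rewrite ltrDl.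
exists (rnorm (M + 1) + 1) => z zD.
have zz : nbhs z [set y | rnorm (z - y) < 1] by apply/nbhs_rnormP; exists 1.
have [y [Dy /= zy]] := zD _ zz.
have := rnormD (z - y) y; rewrite subrK => /le_trans; apply.
rewrite addrC lerD ?(ltW zy) // -lecR -!rnormE.
by rewrite (le_trans (DM y Dy)) // real_ler_norm // realD.
Qed.

Lemma parameter_set_bounded K : closed_jordan_region K \/ line_segment K ->
  closed K /\ exists r : R, forall z, K z -> rnorm z <= r.
Proof.
move=> [/closed_jordan_region_bounded //|/line_segment_compact cK].
split; first by apply: compact_closed cK; exact: norm_hausdorff.
by have [r _ Kr] := compact_rnorm_bounded cK; exists r.
Qed.

End ParameterSetShape.

Section GreenPotential.
Context {R : realType}.
Variables (K : set R[i]) (phi : R[i] -> R[i]).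
Hypothesis phi_conformal : conformal_exterior K phi.

Lemma capacity_le_green z : capacity K <= green K phi z.
Proof.
rewrite /green; case: ifPn => // /negP zK.
have [_ [maps _ _] _] := phi_conformal.
by apply: ltW; apply: (maps z) => /= Kz; apply: zK; rewrite inE.
Qed.

Lemma green_gt_capacity z : capacity K < green K phi z -> ~ K z.
Proof. by rewrite /green => + Kz; rewrite mem_set // ltxx. Qed.

End GreenPotential.

(** * Lower bounds for nodal polynomials at the outer poles *)

Section LargeNodal.
Context {R : realType}.
Variables (lam : nat -> R[i]) (Xi : nat -> seq R[i]).
Hypothesis lam_inj : injective lam.
Hypothesis lam_discrete : forall z, ~ limit_point (range lam) z.
Variables (N : nat) (sigma rho : R).
Hypothesis sigma_gt0 : 0 < sigma.
Hypothesis Xi_size : forall S, (0 < S)%N -> size (Xi S) = S.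
Hypothesis Xi_rho : forall S x, (0 < S)%N -> x \in Xi S -> rnorm x <= rho.
Hypothesis Xi_lower : forall k t, (N <= k)%N -> 0 <= t -> t < sigma ->
  exists S0, forall S, (S0 <= S)%N -> t ^+ S <= rnorm (nodal (Xi S) (lam k)).

(** Upper bound for the residue ratios of a fixed polynomial P of degree at most
    N at the poles from lam N on, with the rate 1 / sigma. On the finitely many
    poles in a disc P is bounded and the hypothesis on the nodal polynomials
    applies; outside, N of the S factors of size at least |l| - r absorb the
    growth of P and each of the S - N others is at least sigma. *)
Lemma poly_le_nodal (P : {poly R[i]}) : (size P <= N.+1)%N ->
  exists2 M : R, 0 <= M & forall eps : R, 0 < eps ->
    exists S0, forall S k, (S0 <= S)%N -> (N <= k)%N ->
      rnorm P.[lam k] <=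
      M * ((1 + eps) / sigma) ^+ S * rnorm (nodal (Xi S) (lam k)).
Proof.
move=> PN; set r := Num.max 0 rho.
have r0 : 0 <= r by rewrite le_max lexx.
set A := \sum_(i < N.+1) rnorm P`_i.
have A0 : 0 <= A by apply: sumr_ge0 => i _; exact: rnorm_ge0.
(* Beyond this radius |l| >= 1, |l| <= 2 (|l| - r) and |l| - r >= sigma. *)
have [n nP] := poles_diverge lam_inj lam_discrete (1 + 2 * r + sigma).
set M1 := \sum_(k < n) rnorm P.[lam k].
have M10 : 0 <= M1 by apply: sumr_ge0 => i _; exact: rnorm_ge0.
exists (M1 + A * (2 * sigma) ^+ N).
  by rewrite addr_ge0 ?mulr_ge0 ?exprn_ge0 // mulr_ge0 // ltW.
move=> eps eps0.
have eps1 : 0 < 1 + eps by rewrite addr_gt0.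
have t0 : 0 <= sigma / (1 + eps) by rewrite divr_ge0 // ltW.
have ts : sigma / (1 + eps) < sigma.
  by rewrite ltr_pdivrMr // ltr_pMr // ltrDl.
have [S0 S0P] : exists S0, forall S, (S0 <= S)%N -> forall k, (k < n)%N ->
    (N <= k)%N -> (sigma / (1 + eps)) ^+ S <= rnorm (nodal (Xi S) (lam k)).
  apply: eventually_forall_lt => k _; have [Nk|kN] := leqP N k.
    by have [S0 S0P] := Xi_lower Nk t0 ts; exists S0 => S /S0P.
  by exists 0%N.
have q0 S : 0 <= ((1 + eps) / sigma) ^+ S by rewrite exprn_ge0 // divr_ge0 ?ltW.
exists (maxn S0 N.+1) => S k; rewrite geq_max => /andP[S0S NS] Nk.
have Spos : (0 < S)%N by apply: leq_ltn_trans NS.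
rewrite -mulrA mulrDl; have [kn|nk] := ltnP k n.
  rewrite (le_trans (_ : _ <= M1 * 1)) //.
    rewrite mulr1 /M1 (bigD1 (Ordinal kn)) //= lerDl.
    by apply: sumr_ge0 => i _; exact: rnorm_ge0.
  rewrite -[leLHS]addr0 lerD //; last first.
    have s2 : 0 <= 2 * sigma by rewrite mulr_ge0 // ltW.
    by rewrite mulr_ge0 ?(mulr_ge0 (q0 S)) ?(mulr_ge0 A0) ?rnorm_ge0 ?exprn_ge0.
  rewrite ler_wpM2l // -[leLHS](@mulVf _ ((sigma / (1 + eps)) ^+ S)); last first.
    by rewrite expf_neq0 // mulf_neq0 ?invr_neq0 ?gt_eqF.
  by rewrite -exprVn invf_div ler_wpM2l // S0P.
have := nP k nk; set l := rnorm (lam k) => lk.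
have l1 : 1 <= l by move: lk; have := sigma_gt0; lra.
have rl : r <= l by move: lk; have := sigma_gt0; lra.
have Xr x : x \in Xi S -> rnorm x <= r.
  by move=> /(Xi_rho Spos); rewrite /r le_max orbC => ->.
rewrite (le_trans (rnorm_horner_le PN l1)) // -[leLHS]add0r lerD //.
  by rewrite !mulr_ge0 ?rnorm_ge0.
rewrite -mulrA ler_wpM2l //.
have nod := rnorm_nodal_ge Xr rl; rewrite Xi_size // -/l in nod.
have h1 : l ^+ N <= 2 ^+ N * (l - r) ^+ N.
  rewrite -exprMn lerXn2r ?nnegrE ?mulr_ge0 ?subr_ge0 //.
    by apply: le_trans l1.
  by move: lk; have := sigma_gt0; lra.
have h2 : sigma ^+ (S - N) * (l - r) ^+ N <= rnorm (nodal (Xi S) (lam k)).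
  rewrite (le_trans _ nod) // -[X in _ <= _ ^+ X](subnK (ltnW NS)) exprD.
  rewrite ler_wpM2r ?exprn_ge0 ?subr_ge0 // lerXn2r ?nnegrE ?subr_ge0 ?ltW //;
    by move: lk; have := sigma_gt0; lra.
have h3 : 1 <= (1 + eps) ^+ S by rewrite exprn_ege1 // lerDl ltW.
rewrite -/l (le_trans h1) // exprMn -!mulrA ler_wpM2l ?exprn_ge0 //.
have sE : sigma ^+ N * ((1 + eps) / sigma) ^+ S * (sigma ^+ (S - N) * (l - r) ^+ N) =
    (1 + eps) ^+ S * (l - r) ^+ N.
  rewrite expr_div_n -[in (sigma ^+ S)^-1](subnK (ltnW NS)) exprD.
  field.
  by rewrite !expf_neq0 // gt_eqF.
rewrite mulrA.
apply: (le_trans _ (ler_wpM2l _ h2)); last first.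
  by rewrite mulr_ge0 // exprn_ge0 // ltW.
by rewrite sE ler_peMl // exprn_ge0 // subr_ge0.
Qed.

End LargeNodal.

(** * Normalized denominators that are small at all but one node *)

Lemma rnorm_horner_bounded {R : realType} (Q : {poly R[i]}) (M : R) :
  exists A : R, forall z, rnorm z <= M -> rnorm Q.[z] <= A.
Proof.
exists (\sum_(i < size Q) rnorm Q`_i * M ^+ i) => z zM.
rewrite horner_coef (le_trans (rnorm_sum _ _ _)) // ler_sum // => i _.
rewrite rnormM rnormX ler_wpM2l ?rnorm_ge0 // lerXn2r ?nnegrE ?rnorm_ge0 //.
by rewrite (le_trans (rnorm_ge0 z)).
Qed.

Section Denominators.
Context {R : realType}.
Variables (N : nat) (ip : {dot {poly_N.+1 R[i]} for (@Num.conj R[i])}).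
Implicit Types P Q : {poly_N.+1 R[i]}.

Lemma hnormE Q : hnorm ip Q = (rnorm (hnorm ip Q))%:C%C.
Proof. by apply: rnorm_pos; rewrite /hnorm sqrtC_ge0. Qed.

Lemma hnormD P Q :
  rnorm (hnorm ip (P + Q)) <= rnorm (hnorm ip P) + rnorm (hnorm ip Q).
Proof. by rewrite -lecR rmorphD /= -!hnormE /hnorm triangle_lerif. Qed.

Lemma hnormZ c Q : hnorm ip (c *: Q) = `|c| * hnorm ip Q.
Proof.
by rewrite /hnorm dnormZ rootCMl ?exprn_ge0 // sqrCK.
Qed.

Lemma hnorm_neq0 Q : Q != 0 -> hnorm ip Q != 0.
Proof. by rewrite /hnorm sqrtC_eq0 dnorm_eq0. Qed.

Lemma hnorm_sum (I : Type) (s : seq I) (c : I -> R[i]) (F : I -> {poly_N.+1 R[i]}) :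
  rnorm (hnorm ip (\sum_(i <- s) c i *: F i)) <=
  \sum_(i <- s) rnorm (c i) * rnorm (hnorm ip (F i)).
Proof.
elim: s => [|i s IHs].
  by rewrite !big_nil -(scale0r (0 : {poly_N.+1 R[i]})) hnormZ normr0 mul0r rnorm0.
rewrite !big_cons (le_trans (hnormD _ _)) // lerD // hnormZ rnormM.
by rewrite rnormE rnorm_real ?rnorm_ge0.
Qed.

Variable x : nat -> R[i].
Hypothesis x_inj : injective x.

Definition node_poly (i : 'I_N.+1) : {poly_N.+1 R[i]} := tnth (N.+1.-lagrange x) i.
Local Notation L := node_poly.

Lemma node_poly_sum Q : Q = \sum_(i < N.+1) Q.[x i] *: L i.
Proof.
apply: val_inj => /=; rewrite raddf_sum /=.
rewrite [LHS](lagrange_gen (ltn0Sn N) x_inj (size_npoly Q)).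
by apply: eq_bigr => i _; rewrite mul_polyC.
Qed.

Lemma node_poly_sample (i j : 'I_N.+1) : (L i).[x j] = (i == j)%:R.
Proof. exact: lagrange_sample. Qed.

Lemma node_poly_neq0 i : L i != 0.
Proof.
apply/eqP => Li; have := node_poly_sample i i; rewrite Li horner0 eqxx.
by move/esym/eqP; rewrite oner_eq0.
Qed.

(** The zeros of a Lagrange basis polynomial are the other nodes, so it is
    bounded below wherever these are at distance at least d. *)
Lemma node_poly_far (i : 'I_N.+1) (d : R) : 0 < d ->
  exists2 c : R, 0 < c & forall z, (forall j, j != i -> d <= rnorm (x j - z)) ->
    c <= rnorm (L i).[z].
Proof.
move=> d0; have Li := lagrangeE (ltn0Sn N) x_inj i.
rewrite /node_poly /=; set p := \prod_(j < N.+1 | j != i) ('X - (x j)%:P) in Li.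
have pi0 : p.[x i] != 0.
  rewrite horner_prod; apply/prodf_neq0 => j ji; rewrite hornerXsubC subr_eq0.
  by rewrite (inj_eq x_inj) eq_sym; apply: contra ji => /eqP/val_inj ->.
exists (rnorm p.[x i]^-1 * \prod_(j < N.+1 | j != i) d).
  by rewrite mulr_gt0 ?prodr_gt0 // rnorm_gt0 invr_eq0.
move=> z zd; rewrite [X in rnorm X.[z]]Li hornerM hornerC rnormM ler_wpM2l ?rnorm_ge0 //.
rewrite /p horner_prod rnorm_prod ler_prod // => j ji.
by rewrite hornerXsubC rnormBC (ltW d0) zd.
Qed.

(** If a unit vector is small at x 0, ..., x (N - 1), then in the Lagrange basis
    its component along the last basis polynomial cannot be small. That
    polynomial is bounded below on E, and the other components are dominated by
    it there. *)
Lemma denominator_lower_bound (E : set R[i]) (M d : R) : 0 < d ->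
  (forall z, E z -> rnorm z <= M) ->
  (forall z k, E z -> d <= rnorm (x k - z)) ->
  exists eta c : R, [/\ 0 < eta, 0 < c & forall Q, hnorm ip Q = 1 ->
    (forall k, (k < N)%N -> rnorm Q.[x k] <= eta) ->
    forall z, E z -> c <= rnorm Q.[z]].
Proof.
move=> d0 EM Ed.
have [c0 c0_gt0 c0P] := node_poly_far ord_max d0.
have [A AP] := choice (fun i => rnorm_horner_bounded (L i) M).
set H := \sum_(i < N) rnorm (hnorm ip (L (widen_ord (leqnSn N) i))).
have H0 : 0 <= H by apply: sumr_ge0 => i _; exact: rnorm_ge0.
set HN := rnorm (hnorm ip (L ord_max)).
have HN0 : 0 <= HN by exact: rnorm_ge0.
set AA := \sum_(i < N) `|A (widen_ord (leqnSn N) i)|.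
have AA0 : 0 <= AA by exact: sumr_ge0.
have H1 : 0 < 2 * (H + 1) by rewrite mulr_gt0 // ltr_pwDr.
have HN1 : 0 < HN + 1 by rewrite ltr_pwDr.
have AA1 : 0 < AA + 1 by rewrite ltr_pwDr.
(* At least 1 / (2 (HN + 1)) of the last component survives, worth 2 c on E;
   eta is such that the other components cost at most c there. *)
set c := c0 / (4 * (HN + 1)).
have c_gt0 : 0 < c by rewrite divr_gt0 // mulr_gt0.
set eta := Num.min (2 * (H + 1))^-1 (c / (AA + 1)).
have eta0 : 0 < eta by rewrite lt_min invr_gt0 H1 divr_gt0.
have etaH : eta * H <= 1 / 2.
  rewrite (le_trans (ler_wpM2l (ltW eta0) (_ : H <= H + 1))) ?lerDl //.
  rewrite -ler_pdivlMr ?ltr_pwDr // (le_trans (_ : _ <= (2 * (H + 1))^-1)) //.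
    by rewrite ge_min lexx.
  by rewrite invfM mul1r.
have etaA : eta * AA <= c.
  rewrite (le_trans (ler_wpM2l (ltW eta0) (_ : AA <= AA + 1))) ?lerDl //.
  by rewrite -ler_pdivlMr // ge_min lexx orbT.
exists eta, c; split => // Q Q1 Qeta z Ez.
have b_ge : 1 / 2 <= rnorm Q.[x N] * (HN + 1).
  have := @hnorm_sum _ (index_enum 'I_N.+1) (fun i => Q.[x i]) L.
  rewrite -node_poly_sum Q1 rnorm1 big_ord_recr /= => le1.
  have : \sum_(i < N) rnorm Q.[x i] * rnorm (hnorm ip (L (widen_ord (leqnSn N) i)))
      <= eta * H.
    by rewrite mulr_sumr ler_sum // => i _; rewrite ler_wpM2r ?rnorm_ge0 // Qeta.
  move: le1 etaH; rewrite -/HN; have := rnorm_ge0 Q.[x N].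
  by lra.
have LN : c0 <= rnorm (L ord_max).[z] by apply: c0P => j _; exact: Ed.
have -> : Q.[z] = Q.[x N] * (L ord_max).[z] +
    \sum_(i < N) Q.[x i] * (L (widen_ord (leqnSn N) i)).[z].
  rewrite [in LHS](node_poly_sum Q) raddf_sum /= horner_sum big_ord_recr /= addrC.
  by congr (_ + _); [|apply: eq_bigr => i _]; rewrite hornerZ.
set s := \sum_(i < N) _.
have s_le : rnorm s <= c.
  rewrite (le_trans _ etaA) // (le_trans (rnorm_sum _ _ _)) // mulr_sumr ler_sum // => i _.
  rewrite rnormM ler_pM ?rnorm_ge0 ?Qeta //.
  by rewrite (le_trans (AP _ _ (EM z Ez))) // ler_norm.
have bL : 2 * c <= rnorm (Q.[x N] * (L ord_max).[z]).
  rewrite rnormM (le_trans _ (ler_wpM2l (rnorm_ge0 _) LN)) //.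
  have -> : 2 * c = c0 * (1 / 2) / (HN + 1) by rewrite /c; field; rewrite gt_eqF.
  by rewrite ler_pdivrMr // [leRHS]mulrAC -mulrA mulrC -mulrA [X in _ <= X]mulrC; nra.
rewrite -[s]opprK (le_trans _ (rnormB _ _)) // rnormN.
by move: bL s_le; lra.
Qed.

End Denominators.

(** * Asymptotics of the minimal denominators *)

Section MinimalDenominators.
Context {R : realType} {V : completeNormedModType R[i]}.
Variable dot : {dot V for (@Num.conj R[i])}.
Hypothesis dot_norm : forall x : V, dot x x = `|x| ^+ 2.
Variables (w : nat -> V) (B : R).
Hypothesis w_orth : forall i j, i != j -> dot (w i) (w j) = 0.
Hypothesis B_ge0 : 0 <= B.
Hypothesis w_sqr : forall n, \sum_(0 <= k < n) rnorm (w k) ^+ 2 <= B ^+ 2.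
Variable lam : nat -> R[i].
Hypothesis lam_inj : injective lam.
Hypothesis lam_discrete : forall z, ~ limit_point (range lam) z.
Variable u : R[i] -> V.
Hypothesis uE : forall z, ~ range lam z -> u z = cauchy_series w lam 1 (fun=> 1) z.
Variables (Xi : nat -> seq R[i]) (N : nat) (sigma rho : R).
Hypothesis sigma_gt0 : 0 < sigma.
Hypothesis Xi_size : forall S, (0 < S)%N -> size (Xi S) = S.
Hypothesis Xi_lam : forall S x, (0 < S)%N -> x \in Xi S -> ~ range lam x.
Hypothesis Xi_rho : forall S x, (0 < S)%N -> x \in Xi S -> rnorm x <= rho.
Hypothesis Xi_lower : forall k t, (N <= k)%N -> 0 <= t -> t < sigma ->
  exists S0, forall S, (S0 <= S)%N -> t ^+ S <= rnorm (nodal (Xi S) (lam k)).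
Variable ip : {dot {poly_N.+1 R[i]} for (@Num.conj R[i])}.
Variable Q : nat -> {poly_N.+1 R[i]}.
Hypothesis Q_minimal : forall S, (N < S)%N -> minimal_denominator ip u (Xi S) (Q S).

Let size_le S (P : {poly_N.+1 R[i]}) : (N < S)%N -> (size P <= size (Xi S))%N.
Proof.
by move=> NS; rewrite Xi_size ?(leq_ltn_trans _ NS) // (leq_trans (size_npoly P)).
Qed.

Lemma jfun_oseries S (P : {poly_N.+1 R[i]}) : (N < S)%N ->
  jfun u (Xi S) P = rnorm (oseries w (residue_ratio lam (Xi S) P)).
Proof.
move=> NS; have S0 : (0 < S)%N by apply: leq_ltn_trans NS.
apply: (jfunE dot_norm w_orth B_ge0 w_sqr lam_inj lam_discrete uE).
- by move=> x; exact: Xi_lam.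
- exact: size_le.
- by rewrite -size_eq0 Xi_size // -lt0n.
Qed.

(** Compare with the normalized Lagrange polynomial attached to lam N: it
    vanishes at lam 0, ..., lam (N - 1), so only poles on levels at least sigma
    contribute to its functional. *)
Lemma minimal_jfun_le : exists2 C : R, 0 <= C & forall eps : R, 0 < eps ->
  exists S0, forall S, (S0 <= S)%N ->
    jfun u (Xi S) (Q S) <= C * ((1 + eps) / sigma) ^+ S.
Proof.
set L : {poly_N.+1 R[i]} := node_poly lam ord_max.
have L0 : hnorm ip L != 0 by apply: hnorm_neq0; exact: node_poly_neq0.
have [M M0 MP] := poly_le_nodal lam_inj lam_discrete sigma_gt0 Xi_size Xi_rho
  Xi_lower (size_npoly L).
set P := (hnorm ip L)^-1 *: L; set h := rnorm (hnorm ip L)^-1.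
have P1 : hnorm ip P = 1.
  rewrite hnormZ ger0_norm ?mulVf // invr_ge0 hnormE.
  by rewrite ler0c rnorm_ge0.
have h0 : 0 <= h by exact: rnorm_ge0.
exists (B * (h * M)); first by rewrite !mulr_ge0.
move=> eps eps0; have [S0 S0P] := MP eps eps0.
exists (maxn S0 N.+1) => S; rewrite geq_max => /andP[S0S NS].
have Spos : (0 < S)%N by apply: leq_ltn_trans NS.
have [_ /(_ P P1)/le_trans] := Q_minimal NS; apply.
rewrite jfun_oseries // -mulrA.
apply: (oseries_bound dot_norm w_orth B_ge0 w_sqr) => k.
have nod : 0 < rnorm (nodal (Xi S) (lam k)).
  rewrite rnorm_gt0; apply: nodal_pole_neq0 => x; exact: Xi_lam.
rewrite /residue_ratio rnormM rnormV ler_pdivrMr //= hornerZ rnormM -!mulrA.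
rewrite ler_wpM2l // mulrA.
have [Nk|kN] := leqP N k; first exact: S0P.
have -> : L.[lam k] = 0.
  have kN1 : (k < N.+1)%N by rewrite ltnS ltnW.
  rewrite (node_poly_sample lam_inj ord_max (Ordinal kN1)).
  by rewrite -val_eqE /= gtn_eqF.
rewrite rnorm0 mulr_ge0 ?rnorm_ge0 // mulr_ge0 // exprn_ge0 // divr_ge0 ?ltW //.
by rewrite addr_gt0.
Qed.

(** By orthogonality |Q(lam k)| |w k| is at most the functional times
    |nodal (lam k)|, hence at most a constant times ((1 + eps) t / sigma)^S, and eps
    can be taken so small that this ratio is below 1. *)
Lemma minimal_denominator_small k (t e : R) : w k != 0 ->
  0 <= t -> t < sigma ->
  (exists S0, forall S, (S0 <= S)%N -> rnorm (nodal (Xi S) (lam k)) <= t ^+ S) ->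
  0 < e ->
  exists S0, forall S, (S0 <= S)%N -> rnorm (Q S).[lam k] <= e.
Proof.
move=> wk t0 ts [S1 S1P] e0.
have [C C0 CP] := minimal_jfun_le.
have wk0 : 0 < rnorm (w k) by rewrite rnorm_gt0.
(* eps spends half of the gap between t and sigma. *)
have [eps [eps0 q1]] : exists eps, 0 < eps /\ (1 + eps) * t < sigma.
  exists ((sigma - t) / (2 * sigma)); split.
    by rewrite divr_gt0 ?subr_gt0 // mulr_gt0.
  rewrite mulrDl mul1r -ltrBrDl (le_lt_trans (_ : _ <= (sigma - t) / 2)) //.
    have -> : (sigma - t) / (2 * sigma) * t = (sigma - t) / 2 * (t / sigma).
      by field; rewrite gt_eqF.
    by rewrite ler_piMr ?divr_ge0 ?subr_ge0 ?ler_pdivrMr ?mul1r ?ltW.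
  by rewrite ltr_pdivrMr // ltr_pMr ?subr_gt0 // ltr1n.
have eps1 : 0 < 1 + eps by rewrite addr_gt0.
have [S2 S2P] := CP eps eps0.
set q := (1 + eps) / sigma * t.
have q0 : 0 <= q by rewrite mulr_ge0 // divr_ge0 // ltW.
have {}q1 : q < 1 by rewrite /q mulrAC ltr_pdivrMr // mul1r.
have C1 : 0 < C + 1 by rewrite ltr_pwDr.
have [S3 S3P] := geometric_eventually_le q0 q1 (divr_gt0 (mulr_gt0 e0 wk0) C1).
exists (maxn S1 (maxn S2 (maxn S3 N.+1))) => S.
rewrite !geq_max => /and4P[S1S S2S S3S NS].
have Spos : (0 < S)%N by apply: leq_ltn_trans NS.
have XS x : x \in Xi S -> ~ range lam x by exact: Xi_lam.
have ba := bounded_residue_ratio lam_inj lam_discrete XS (size_le (Q S) NS).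
have := oseries_ge dot_norm w_orth w_sqr k ba.
rewrite -jfun_oseries // => /le_trans/(_ (S2P S S2S)).
have nod : 0 < rnorm (nodal (Xi S) (lam k)).
  by rewrite rnorm_gt0; apply: nodal_pole_neq0 => x; exact: Xi_lam.
rewrite /residue_ratio rnormM rnormV -ler_pdivlMr // ler_pdivrMr // => /le_trans.
apply; rewrite mulrAC ler_pdivrMr //.
rewrite -mulrA (le_trans (ler_wpM2l C0 (ler_wpM2l _ (S1P S S1S)))) //.
  by rewrite exprn_ge0 // divr_ge0 // ltW.
rewrite -exprMn -/q (le_trans (ler_wpM2l C0 (S3P S S3S))) //.
by rewrite mulrA ler_pdivrMr // mulrC ler_wpM2l ?lerDl // mulr_ge0 // ltW.
Qed.

End MinimalDenominators.

(** The unordered sum over A is the sum along the enumeration; B is its square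
    root, so that B bounds oseries on sequences bounded by 1. *)
Lemma summable_enumeration {R : realType} (T : choiceType) (A : set T)
    (f : T -> R) (s : nat -> T) : (forall x, 0 <= f x) ->
  set_bij [set: nat] A s -> (\esum_(x in A) (f x)%:E < +oo)%E ->
  exists2 B : R, 0 <= B & forall n, \sum_(0 <= k < n) f (s k) <= B ^+ 2.
Proof.
move=> f0 sA; rewrite (reindex_esum [set: nat] A s) // => Afin.
have fs0 : forall n : nat, (0 <= n)%N -> true -> (0 <= (f (s n))%:E)%E.
  by move=> n _ _; rewrite lee_fin.
set e := esum _ _ in Afin.
have e0 : (0 <= e)%E by apply: esum_ge0 => n _; rewrite lee_fin.
exists (Num.sqrt (fine e)); first exact: sqrtr_ge0.
move=> n; rewrite sqr_sqrtr ?fine_ge0 // -lee_fin fineK ?ge0_fin_numE //.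
rewrite /e -nneseries_esumT; last by move=> k; rewrite lee_fin.
by rewrite -sumEFin; exact: nneseries_lim_ge.
Qed.

(** * Convergence of the minimal rational interpolants *)

Theorem theorem10 (R : realType)
  (V : completeNormedModType R[i])
  (dot : {dot V for (@Num.conj R[i])})
  (dot_norm : forall x : V, dot x x = `|x| ^+ 2)
  (Lam : set R[i]) (v : R[i] -> V) (u : R[i] -> V)
  (Lam_countable : countable Lam)
  (Lam_infinite : infinite_set Lam)
  (Lam_discrete : forall z : R[i], ~ limit_point Lam z)
  (v_neq0 : forall l, Lam l -> v l != 0)
  (v_summable : (\esum_(l in Lam) (rnorm (v l) ^+ 2)%:E < +oo)%E)
  (v_orthogonal : forall l l', Lam l -> Lam l' -> l != l' ->
     dot (v l) (v l') = 0)
  (u_meromorphic : meromorphic_simple_poles Lam u)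
  (u_expansion : pole_expansion Lam v u)
  (K : set R[i]) (phi : R[i] -> R[i])
  (K_shape : closed_jordan_region K \/ line_segment K)
  (K_capacity : 0 < capacity K)
  (phi_conformal : conformal_exterior K phi)
  (lam : nat -> R[i])
  (lam_enum : ordered_enumeration Lam (green K phi) lam)
  (Xi : nat -> seq R[i])
  (Xi_fejer : forall S, (1 <= S)%N -> fejer_points K phi S (Xi S))
  (Xi_sub : forall S x, (1 <= S)%N -> x \in Xi S -> K x)
  (Xi_limsup : limsup_le_compacts (nodal_root Xi) (green K phi))
  (Xi_lim : lim_compacts_in (~` frontier K) (nodal_root Xi) (green K phi))
  (Xi_not_pole : forall S x, (1 <= S)%N -> x \in Xi S -> ~ Lam x)
  (N : nat)
  (ip : {dot {poly_N.+1 R[i]} for (@Num.conj R[i])})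
  (lam_outside : capacity K < green K phi (lam N))
  (lam_gap : level_gap (green K phi) lam N)
  (E : set R[i])
  (E_compact : compact E)
  (E_sub : E `<=` [set z | green K phi z < green K phi (lam N)] `\` Lam)
  (Q : nat -> {poly_N.+1 R[i]})
  (Q_minimal : forall S, (N < S)%N -> minimal_denominator ip u (Xi S) (Q S)) :
  exists C : R, forall eps : R, 0 < eps ->
    exists S0 : nat, forall (z : R[i]) (S : nat), E z -> (S0 < S)%N ->
      (Q S : {poly R[i]}).[z] != 0 /\
      rnorm (u z - rational_interpolant u (Xi S) (Q S) z)
        <= C * (1 + eps) ^+ (2 * S)
             * (green K phi z / green K phi (lam N)) ^+ S.
Proof.
have [lam_bij lam_mono] := lam_enum.
have LamE : Lam = range lam.
  have [lamL _ lam_surj] := lam_bij; apply/seteqP; split => z; last first.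
    by move=> [k _ <-]; exact: lamL.
  by move/lam_surj => [k _ kz]; exists k.
have Lam_lam k : Lam (lam k) by rewrite LamE; exists k.
have lam_inj : injective lam.
  have [_ linj _] := lam_bij => i j ij; by apply: linj; rewrite ?inE.
have lam_discrete z : ~ limit_point (range lam) z by rewrite -LamE.
pose w k := v (lam k).
have w_orth i j : i != j -> dot (w i) (w j) = 0.
  by move=> ij; apply: v_orthogonal => //; rewrite (inj_eq lam_inj).
have [B B0 w_sqr] := summable_enumeration (fun l => sqr_ge0 (rnorm (v l)))
  lam_bij v_summable.
have uE z : ~ range lam z -> u z = cauchy_series w lam 1 (fun=> 1) z.
  rewrite -LamE => zL; apply/esym/oseries_unique.
  under eq_fun do under eq_bigr do rewrite mul1r expr1.
  exact: u_expansion.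
(* From here on the poles enter only through their enumeration and levels. *)
set sigma := green K phi (lam N) in lam_outside E_sub *.
have sigma0 : 0 < sigma by apply: lt_trans lam_outside.
have [K_closed [rho K_rho]] := parameter_set_bounded K_shape.
have Xi_size S : (0 < S)%N -> size (Xi S) = S by case/Xi_fejer.
have Xi_lam S x : (0 < S)%N -> x \in Xi S -> ~ range lam x.
  by rewrite -LamE; exact: Xi_not_pole.
have Xi_rho S x : (0 < S)%N -> x \in Xi S -> rnorm x <= rho.
  by move=> S0 /(Xi_sub _ _ S0); exact: K_rho.
have Xi_lower k t : (N <= k)%N -> 0 <= t -> t < sigma ->
    exists S0, forall S, (S0 <= S)%N -> t ^+ S <= rnorm (nodal (Xi S) (lam k)).
  move=> Nk t0 ts; have sk : sigma <= green K phi (lam k) by exact: lam_mono.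
  have lamK : ~ K (lam k).
    by apply: (green_gt_capacity (phi := phi)); exact: lt_le_trans sk.
  have lamF : [set lam k] `<=` ~` frontier K.
    by move=> _ -> -[+ _]; rewrite -((closure_id K).1 K_closed).
  have e0 : 0 < sigma - t by rewrite subr_gt0.
  have [S0 S0P] := Xi_lim _ (@compact_set1 _ (lam k)) lamF _ e0.
  exists (maxn 1 S0) => S; rewrite geq_max => /andP[S1 S0S].
  apply: nodal_root_ge => //.
  have := S0P S (lam k) S0S erefl; rewrite ltr_norml => /andP[+ _].
  by move: sk; lra.
have [d d0 dP] : exists2 d : R, 0 < d & forall z k, E z -> d <= rnorm (lam k - z).
  apply: poles_away_from_compact => // k /E_sub[_]; exact.
have [M M0 EM] := compact_rnorm_bounded E_compact.
have [C C0 CP] := minimal_jfun_le dot_norm w_orth B0 w_sqr lam_inj lam_discrete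
  uE sigma0 Xi_size Xi_lam Xi_rho Xi_lower Q_minimal.
have [eta [c [eta0 c0 cP]]] := denominator_lower_bound ip lam_inj d0 EM dP.
have [S1 S1P] : exists S1, forall S, (S1 <= S)%N -> forall k, (k < N)%N ->
    rnorm (Q S).[lam k] <= eta.
  apply: eventually_forall_lt => k kN.
  have := lam_gap k kN; rewrite -/sigma => ks.
  set t := (green K phi (lam k) + sigma) / 2.
  have g0 : 0 <= green K phi (lam k).
    by rewrite (le_trans (ltW K_capacity)) // capacity_le_green.
  have e0 : 0 < t - green K phi (lam k) by rewrite /t; lra.
  have t0 : 0 <= t by rewrite /t; lra.
  have ts : t < sigma by rewrite /t; lra.
  apply: (minimal_denominator_small dot_norm w_orth B0 w_sqr lam_inj lam_discrete
    uE sigma0 Xi_size Xi_lam Xi_rho Xi_lower Q_minimal _ t0 ts) => //.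
    exact: v_neq0.
  have [S0 S0P] := Xi_limsup _ (@compact_set1 _ (lam k)) _ e0.
  exists (maxn 1 S0) => S; rewrite geq_max => /andP[S1 S0S].
  by apply: nodal_root_le => //; rewrite (le_trans (S0P S (lam k) S0S erefl)) // subrKC.
exists (C / (c * d)) => eps eps0.
have [S2 S2P] := CP eps eps0.
(* An additive error eps * capacity K is a relative error eps for the
   potential, which is at least the capacity. *)
have ek0 : 0 < eps * capacity K by rewrite mulr_gt0.
have [S3 S3P] := Xi_limsup E E_compact _ ek0.
exists (maxn N (maxn S1 (maxn S2 S3))) => z S Ez.
rewrite !gtn_max => /and4P[NS S1S S2S S3S].
have Spos : (0 < S)%N by apply: leq_ltn_trans NS.
have zlam : ~ range lam z by rewrite -LamE; have [] := E_sub z Ez.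
have [Q1 _] := Q_minimal S NS.
have Qz : c <= rnorm (Q S).[z] by apply: cP => //; exact: S1P (ltnW S1S).
have Qz0 : 0 < rnorm (Q S).[z] by apply: lt_le_trans Qz.
split; first by rewrite -rnorm_gt0.
have QS : (size (Q S) <= size (Xi S))%N.
  by rewrite Xi_size // (leq_trans (size_npoly _)).
have XS x : x \in Xi S -> ~ range lam x by exact: Xi_lam.
set a := residue_ratio lam (Xi S) (Q S).
have ba : bounded_coef a by exact: bounded_residue_ratio.
have -> : u z - rational_interpolant u (Xi S) (Q S) z =
    (Q S).[z]^-1 *: (nodal (Xi S) z *: cauchy_series w lam 1 a z).
  rewrite -(interpolation_error dot_norm w_orth B0 w_sqr lam_inj lam_discrete uE) //.
  rewrite scalerBr.
  by rewrite /scaled scalerA mulVf ?scale1r // -rnorm_gt0.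
rewrite !rnormZ rnormV.
have nod_le : rnorm (nodal (Xi S) z) <= ((1 + eps) * green K phi z) ^+ S.
  apply: nodal_root_le => //.
  rewrite (le_trans (S3P S z (ltnW S3S) Ez)) // mulrDl mul1r lerD2l.
  by rewrite ler_wpM2l ?(ltW eps0) // capacity_le_green.
have series_le : rnorm (cauchy_series w lam 1 a z) <= d^-1 * (C * ((1 + eps) / sigma) ^+ S).
  rewrite (le_trans (_ : _ <= d^-1 * rnorm (oseries w a))) //.
    apply: (oseries_le dot_norm w_orth w_sqr ba); first by rewrite invr_ge0 ltW.
    move=> k; rewrite expr1 rnormM mulrC rnormV ler_wpM2r ?rnorm_ge0 //.
    by rewrite lef_pV2 ?posrE ?(lt_le_trans d0) ?dP.
  rewrite ler_wpM2l ?invr_ge0 ?(ltW d0) //.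
  rewrite -(jfun_oseries dot_norm w_orth B0 w_sqr lam_inj lam_discrete uE Xi_size Xi_lam) //.
  exact: S2P (ltnW S2S).
have -> : C / (c * d) * (1 + eps) ^+ (2 * S) * (green K phi z / sigma) ^+ S =
   c^-1 * (((1 + eps) * green K phi z) ^+ S * (d^-1 * (C * ((1 + eps) / sigma) ^+ S))).
  rewrite !expr_div_n exprMn mul2n -addnn exprD; field.
  by rewrite !gt_eqF // exprn_gt0.
apply: ler_pM; rewrite ?invr_ge0 ?mulr_ge0 ?rnorm_ge0 // ?lef_pV2 ?posrE //.
by apply: ler_pM; rewrite ?rnorm_ge0.
Qed.
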